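(* Let $G$ be a finite group and let $F$ be an additive contravariant functor from the category of finite $G$-sets to the category of monoids. If $F$ is moreover a semi-Mackey functor, i.e. if there exists a semi-Mackey functor $(M^*,M_* )$ on $G$ whose contravariant part is $M^*=F$, then the $F$-Burnside ring functor $\mathcal{A}_F$ has a structure of a Tambara functor; that is, there is a Tambara functor $(T^*,T_+,T_\bullet)$ on $G$ whose underlying Green functor $(T^*,T_+)$ is $\mathcal{A}_F$.
   Context: Conventions. ${}_G\mathit{set}$ is the category of finite $G$-sets. Monoids are commutative with unit $1$; semi-rings and rings are commutative with $0$ and $1$; homomorphisms preserve these. ''Additive'' means that finite coproducts are sent to products (via the inclusions). Semi-Mackey functors. A semi-Mackey functor $M=(M^*,M_* )$ on $G$ is a contravariant functor $M^*$ and a covariant functor $M_*$ from ${}_G\mathit{set}$ to monoids with $M^*(X)=M_*(X)=:M(X)$, such that $M^*(f)M_*(g)=M_*(g')M^*(f')$ for every pull-back square with sides $g'\colon X'\to Y'$, $f'\colon X'\to X$, $f\colon Y'\to Y$, $g\colon X\to Y$, and such that $M^*$ is additive. It is a Mackey functor if all $M(X)$ are abelian groups. Green functors. A (commutative) Green functor is a Mackey functor $(M^*,M_* )$ with bilinear cross products $M(X)\times M(Y)\to M(X\times Y)$, natural in $X,Y$ for both $M^*$ and $M_*$, associative, commutative and unital; equivalently the values are rings, the restrictions $M^*(f)$ are ring homomorphisms, and $M_*(f)(x\cdot M^*(f)(y))=M_*(f)(x)\cdot y$. Tambara functors. For $\eta\colon X\to Y$ and $p\colon A\to X$ in ${}_G\mathit{set}$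 put $\Pi_\eta(A)=\{(y,\sigma)\mid y\in Y,\ \sigma\colon\eta^{-1}(y)\to A\text{ a map of sets},\ p\sigma=\mathrm{id}\}$, $\pi(y,\sigma)=y$, $\rho\colon X\times_Y\Pi_\eta(A)\to\Pi_\eta(A)$ the projection, $\lambda\colon X\times_Y\Pi_\eta(A)\to A$, $\lambda(x,(y,\sigma))=\sigma(x)$. A Tambara functor $T=(T^*,T_+,T_\bullet)$ on $G$ assigns to each finite $G$-set $X$ a ring $T(X)$ such that $(T^*,T_+)$ and $(T^*,T_\bullet)$ are semi-Mackey functors for the additive, respectively multiplicative, monoids, and $T_+(\pi)T_\bullet(\rho)T^*(\lambda)=T_\bullet(\eta)T_+(p)$ for all $\eta,p$. Then $(T^*,T_+)$ is a Green functor with cross product $(x,y)\mapsto T^*(p_X)(x)\cdot T^*(p_Y)(y)$, where $p_X,p_Y$ are the projections of $X\times Y$; this is the underlying Green functor of $T$. The $F$-Burnside ring functor. For a finite $G$-set $X$, let $(G,X,F)$ be the category whose objects are pairs $(A\xrightarrow{p}X,m_A)$ with $p$ a map of finite $G$-sets and $m_A\in F(A)$, and whose morphisms $(A\xrightarrow{p}X,m_A)\to(A'\xrightarrow{p'}X,m_{A'})$ are $G$-maps $f\colon A\to A'$ with $p'f=p$ and $F(f)(m_{A'})=m_A$. $\mathcal{A}_F(X)$ is the Grothendieck ring of isomorphism classes in $(G,X,F)$, with sum $(A_1\amalg A_2\to X,m_{A_1}\amalg m_{A_2})$, where $m_{A_1}\amalg m_{A_2}\in F(A_1\amalg A_2)\cong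 F(A_1)\times F(A_2)$ corresponds to $(m_{A_1},m_{A_2})$, and product $(A_1\times_XA_2\to X,F(\varpi_1)(m_{A_1})\cdot F(\varpi_2)(m_{A_2}))$, $\varpi_i$ the projections. $\mathcal{A}_F$ is a Green functor (Jacobson) with restriction along $\zeta\colon Y\to X$ given by $(A\to X,m_A)\mapsto(A\times_XY\to Y,F(\zeta')(m_A))$, where $\zeta'\colon A\times_XY\to A$ is the projection, and transfer along $\xi\colon X\to Y$ given by $(A\xrightarrow{p}X,m_A)\mapsto(A\xrightarrow{\xi p}Y,m_A)$. *)

(* Defs.v *)
From HB Require Import structures.
From mathcomp Require Import all_boot all_order all_algebra all_fingroup.
From mathcomp Require Import boolp classical_sets cardinality ring.

Set Implicit Arguments.
Unset Strict Implicit.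
Unset Printing Implicit Defensive.

Import GRing.Theory.
Local Open Scope ring_scope.
Local Open Scope quotient_scope.

Declare Scope gset_scope.
Local Open Scope gset_scope.

(* Carriers are finite sets in [Set] rather than [finType]s: the G-sets then
   form a type small enough for a quotient of triples (A, p, m_A) to carry a
   MathComp ring structure (with [finType] carriers this is a universe
   inconsistency).  As in MathComp, groups act on the right; right and left
   G-sets correspond via x . g = g^-1 x. *)
Record gset (gT : finGroupType) := GSet {
  gset_sort :> Set;
  gset_finite : finite_set [set: gset_sort]%classic;
  gset_act : {action gT &-> gset_sort} }.

HB.instance Definition _ (gT : finGroupType) (X : gset gT) :=
  gen_eqMixin (gset_sort X).
HB.instance Definition _ (gT : finGroupType) (X : gset gT) :=
  gen_choiceMixin (gset_sort X).

Section GSetFinType.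
Variables (gT : finGroupType) (X : gset gT).

Lemma gset_enum_ex : exists s : seq X, forall x : X, x \in s.
Proof.
have /finite_seqP [s E] := gset_finite X.
by exists s => x; have : [set` s]%classic x by rewrite -E.
Qed.
Definition gset_enum : seq X := undup (sval (cid gset_enum_ex)).

Lemma mem_gset_enum (x : X) : x \in gset_enum.
Proof. by rewrite mem_undup; case: cid. Qed.

Lemma gset_pickleK :
  pcancel (fun x : X => index x gset_enum) (onth gset_enum).
Proof.
by move=> x; rewrite /= onthE (nth_map x) ?index_mem ?nth_index ?mem_gset_enum.
Qed.
HB.instance Definition _ := PCanIsCountable gset_pickleK.

Lemma gset_enumP : Finite.axiom gset_enum.
Proof. by move=> x; rewrite count_uniq_mem ?undup_uniq // mem_gset_enum. Qed.
HB.instance Definition _ := isFinite.Build (gset_sort X) gset_enumP.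
End GSetFinType.

Lemma finite_inj (S : Set) (T : finType) (f : S -> T) :
  injective f -> finite_set [set: S]%classic.
Proof.
move=> f_inj; rewrite -(preimage_setT f); apply: finite_preimage => //.
by move=> x y _ _; exact: f_inj.
Qed.

Definition gop (gT : finGroupType) (X : gset gT) (x : X) (g : gT) : X :=
  gset_act X x g.
Notation "x ⋅ g" := (gop x g) (at level 40, left associativity) : gset_scope.

Lemma gop1 (gT : finGroupType) (X : gset gT) (x : X) : x ⋅ 1%g = x.
Proof. exact: act1. Qed.

Lemma gopM (gT : finGroupType) (X : gset gT) (x : X) (g h : gT) :
  x ⋅ (g * h)%g = x ⋅ g ⋅ h.
Proof. exact: actM. Qed.

Lemma gopK (gT : finGroupType) (X : gset gT) (x : X) (g : gT) :
  x ⋅ g ⋅ g^-1%g = x.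
Proof. by rewrite -gopM mulgV gop1. Qed.

Lemma gopKV (gT : finGroupType) (X : gset gT) (x : X) (g : gT) :
  x ⋅ g^-1%g ⋅ g = x.
Proof. by rewrite -gopM mulVg gop1. Qed.

Record gmap (gT : finGroupType) (X Y : gset gT) := GMap {
  gmap_fun :> X -> Y;
  gmap_equiv : forall (x : X) (g : gT), gmap_fun (x ⋅ g) = gmap_fun x ⋅ g }.

Lemma gmap_eq (gT : finGroupType) (X Y : gset gT) (f g : gmap X Y) :
  f =1 g -> f = g.
Proof.
case: f g => [f Hf] [g Hg] /= /funext E; move: Hf Hg; rewrite E => Hf Hg.
by congr GMap; exact: Prop_irrelevance.
Qed.

Section GSets.
Variable gT : finGroupType.
Implicit Types X Y Z A B : gset gT.

Definition gid X : gmap X X := GMap (fun x g => erefl (x ⋅ g)).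

Lemma gcomp_equiv X Y Z (f : gmap Y Z) (g : gmap X Y) (x : X) (a : gT) :
  f (g (x ⋅ a)) = f (g x) ⋅ a.
Proof. by rewrite !gmap_equiv. Qed.
Definition gcomp X Y Z (f : gmap Y Z) (g : gmap X Y) : gmap X Z :=
  GMap (gcomp_equiv f g).

Lemma gvoid_act1 : (fun (v : void) (_ : gT) => v)^~ 1%g =1 id. Proof. by []. Qed.
Lemma gvoid_actM (v : void) : act_morph (fun (v : void) (_ : gT) => v) v.
Proof. by []. Qed.
Definition gvoid : gset gT :=
  @GSet gT void (finite_inj (@inj_id void)) (TotalAction gvoid_act1 gvoid_actM).

Definition gvoid_map X : gmap gvoid X :=
  @GMap gT gvoid X (fun v : void => match v with end)
    (fun (v : void) g => match v with end).

Definition gsum_op X Y (u : X + Y) (g : gT) : X + Y :=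
  match u with inl x => inl (x ⋅ g) | inr y => inr (y ⋅ g) end.
Lemma gsum_act1 X Y : (@gsum_op X Y)^~ 1%g =1 id.
Proof. by case=> x /=; rewrite gop1. Qed.
Lemma gsum_actM X Y (u : X + Y) : act_morph (@gsum_op X Y) u.
Proof. by case: u => x g h /=; rewrite gopM. Qed.
Definition gsum X Y : gset gT :=
  @GSet gT (X + Y)%type (finite_inj (@inj_id (X + Y)%type))
       (TotalAction (@gsum_act1 X Y) (@gsum_actM X Y)).

Definition ginl X Y : gmap X (gsum X Y) :=
  @GMap gT X (gsum X Y) inl (fun x g => erefl).
Definition ginr X Y : gmap Y (gsum X Y) :=
  @GMap gT Y (gsum X Y) inr (fun x g => erefl).

Definition gcase_fun X Y Z (f : gmap X Z) (h : gmap Y Z) (u : gsum X Y) : Z :=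
  match u with inl x => f x | inr y => h y end.
Lemma gcase_equiv X Y Z (f : gmap X Z) (h : gmap Y Z) (u : gsum X Y) (g : gT) :
  gcase_fun f h (u ⋅ g) = gcase_fun f h u ⋅ g.
Proof. by case: u => x /=; rewrite -gmap_equiv. Qed.
Definition gcase X Y Z (f : gmap X Z) (h : gmap Y Z) : gmap (gsum X Y) Z :=
  GMap (gcase_equiv f h).

Section FibreProduct.
Variables (X Y Z : gset gT) (f : gmap X Z) (h : gmap Y Z).

Definition gpb_sort : Set := {u : X * Y | f u.1 == h u.2}.

Lemma gpb_op_subproof (u : gpb_sort) (g : gT) :
  f ((val u).1 ⋅ g) == h ((val u).2 ⋅ g).
Proof. by rewrite !gmap_equiv (eqP (valP u)). Qed.
Definition gpb_op (u : gpb_sort) (g : gT) : gpb_sort :=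
  exist _ ((val u).1 ⋅ g, (val u).2 ⋅ g) (gpb_op_subproof u g).
Lemma gpb_act1 : gpb_op^~ 1%g =1 id.
Proof. by case=> [[x y] e]; apply: val_inj; rewrite /= !gop1. Qed.
Lemma gpb_actM u : act_morph gpb_op u.
Proof. by case: u => [[x y] e] a b; apply: val_inj; rewrite /= !gopM. Qed.

Definition gpb : gset gT :=
  @GSet gT gpb_sort (finite_inj (@inj_id gpb_sort))
       (TotalAction gpb_act1 gpb_actM).

Definition gpb1 : gmap gpb X :=
  @GMap gT gpb X (fun u => (val u).1) (fun u g => erefl).
Definition gpb2 : gmap gpb Y :=
  @GMap gT gpb Y (fun u => (val u).2) (fun u g => erefl).

Lemma gpbP (u : gpb) : f (gpb1 u) = h (gpb2 u).
Proof. exact/eqP/(valP u). Qed.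

Definition gpb_mk (x : X) (y : Y) (e : f x = h y) : gpb :=
  exist _ (x, y) (introT eqP e).

Lemma gpb_lift_equiv W (a : gmap W X) (b : gmap W Y) (e : forall w, f (a w) = h (b w))
    (w : W) (g : gT) : gpb_mk (e (w ⋅ g)) = gpb_op (gpb_mk (e w)) g.
Proof. by apply: val_inj; rewrite /= !gmap_equiv. Qed.
Definition gpb_lift W (a : gmap W X) (b : gmap W Y)
    (e : forall w, f (a w) = h (b w)) : gmap W gpb :=
  @GMap gT W gpb (fun w => gpb_mk (e w)) (gpb_lift_equiv e).

Lemma gpb_ext (u v : gpb) : gpb1 u = gpb1 v -> gpb2 u = gpb2 v -> u = v.
Proof.
case: u v => [[x y] e] [[x' y'] e'] /= Ex Ey.
by apply: val_inj; rewrite /= Ex Ey.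
Qed.

End FibreProduct.

(*      X' --g'--> Y'
        |f'        |f
        X  --g-->  Y     *)
Definition is_pullback X X' Y Y'
    (f : gmap Y' Y) (g : gmap X Y) (g' : gmap X' Y') (f' : gmap X' X) : Prop :=
  gcomp g f' = gcomp f g' /\
  forall W (a : gmap W X) (b : gmap W Y'), gcomp g a = gcomp f b ->
    exists! u : gmap W X', gcomp f' u = a /\ gcomp g' u = b.

Section DependentProduct.
Variables (A X Y : gset gT) (eta : gmap X Y) (p : gmap A X).

(* The pairs (y, sigma) with sigma : eta^-1(y) -> A a section of p. *)
Record gpi_sort : Set := GPi {
  gpi_pt : Y;
  gpi_sec : {x : X | eta x == gpi_pt} -> A;
  gpi_secP : forall x, p (gpi_sec x) = val x }.
Arguments gpi_sec u x : clear implicits, rename.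

Let fin_sort := {u : {y : Y & {ffun {x : X | eta x == y} -> A}} |
                  [forall x, p (tagged u x) == val x]}.

Lemma gpi_to_fin_subproof (u : gpi_sort) :
  [forall x, p ([ffun z => gpi_sec u z] x) == val x].
Proof. by apply/forallP => x; rewrite ffunE; apply/eqP/gpi_secP. Qed.
Definition gpi_to_fin (u : gpi_sort) : fin_sort :=
  exist _ (Tagged (fun y => {ffun {x : X | eta x == y} -> A})
                  [ffun z => gpi_sec u z]) (gpi_to_fin_subproof u).

Lemma gpi_of_fin_subproof (v : fin_sort) x :
  p (tagged (val v) x) = val x.
Proof. by apply/eqP; move: x; apply/forallP/(valP v). Qed.
Definition gpi_of_fin (v : fin_sort) : gpi_sort :=
  GPi (@gpi_of_fin_subproof v).

Lemma gpi_ext (u v : gpi_sort) :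
  gpi_pt u = gpi_pt v ->
  (forall x h k, gpi_sec u (exist _ x h) = gpi_sec v (exist _ x k)) ->
  u = v.
Proof.
case: u v => [y s sP] [y' s' sP'] /= E; move: s' sP'; rewrite -{y'}E => s' sP' E.
have Es : s = s' by apply/funext => -[x h]; exact: E.
by move: sP'; rewrite -Es => sP'; congr GPi; exact: Prop_irrelevance.
Qed.

Lemma gpi_to_finK : cancel gpi_to_fin gpi_of_fin.
Proof.
move=> u; apply: gpi_ext => //= x h k.
by rewrite ffunE; congr gpi_sec; apply: val_inj.
Qed.

Lemma gpi_op_fib (u : gpi_sort) (g : gT) (x : X) :
  eta x == gpi_pt u ⋅ g -> eta (x ⋅ g^-1%g) == gpi_pt u.
Proof. by move=> /eqP E; rewrite gmap_equiv E gopK. Qed.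

Lemma gpi_op_subproof (u : gpi_sort) (g : gT)
    (x : {x : X | eta x == gpi_pt u ⋅ g}) :
  p (gpi_sec u (exist _ (val x ⋅ g^-1%g) (gpi_op_fib (valP x))) ⋅ g) = val x.
Proof. by rewrite gmap_equiv gpi_secP /= gopKV. Qed.
Definition gpi_op (u : gpi_sort) (g : gT) : gpi_sort :=
  GPi (@gpi_op_subproof u g).

Lemma gpi_act1 : gpi_op^~ 1%g =1 id.
Proof.
move=> u; apply: gpi_ext => [|x h k] /=; rewrite gop1 //.
congr gpi_sec; apply: val_inj; by rewrite /= invg1 gop1.
Qed.
Lemma gpi_actM u : act_morph gpi_op u.
Proof.
move=> a b; apply: gpi_ext => [|x h k] /=; rewrite gopM //.
congr (_ ⋅ _ ⋅ _); congr gpi_sec; apply: val_inj; by rewrite /= invMg gopM.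
Qed.

Definition gpi : gset gT :=
  @GSet gT gpi_sort (finite_inj (can_inj gpi_to_finK))
        (TotalAction gpi_act1 gpi_actM).

Definition gpi_proj : gmap gpi Y :=
  @GMap gT gpi Y gpi_pt (fun u g => erefl).

Definition gpi_rho : gmap (gpb eta gpi_proj) gpi := gpb2 eta gpi_proj.

Definition gpi_eval (w : gpb eta gpi_proj) : A :=
  gpi_sec (gpb2 eta gpi_proj w) (exist _ (gpb1 eta gpi_proj w) (valP w)).
Lemma gpi_eval_equiv (w : gpb eta gpi_proj) (g : gT) :
  gpi_eval (w ⋅ g) = gpi_eval w ⋅ g.
Proof.
rewrite /gpi_eval /=; congr (_ ⋅ _); congr gpi_sec; apply: val_inj.
by rewrite /= gopK.
Qed.
Definition gpi_lambda : gmap (gpb eta gpi_proj) A := GMap gpi_eval_equiv.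

End DependentProduct.
End GSets.
Arguments gpi_sec {gT A X Y eta p} u x : rename.
Arguments gid {gT} X.
Arguments ginl {gT} X Y.
Arguments ginr {gT} X Y.

(* Commutative monoids are [nmodType]s, hence written additively; [multMon R]
   is the multiplicative monoid of R, whose "sum" is the product of R. *)
Definition multMon (R : comPzRingType) : Type := R.
HB.instance Definition _ (R : comPzRingType) := Choice.on (multMon R).
HB.instance Definition _ (R : comPzRingType) :=
  GRing.isNmodule.Build (multMon R) (@mulrA R) (@mulrC R) (@mul1r R).

Section Functors.
Variable gT : finGroupType.

Record is_contravariant (M : gset gT -> nmodType)
    (res : forall X Y, gmap X Y -> M Y -> M X) : Prop := {
  contra_mor : forall X Y (f : gmap X Y), nmod_morphism (res X Y f);
  contra_id : forall X x, res X X (gid X) x = x;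
  contra_comp : forall X Y Z (f : gmap Y Z) (h : gmap X Y) z,
    res X Z (gcomp f h) z = res X Y h (res Y Z f z) }.

Record is_covariant (M : gset gT -> nmodType)
    (tr : forall X Y, gmap X Y -> M X -> M Y) : Prop := {
  cov_mor : forall X Y (f : gmap X Y), nmod_morphism (tr X Y f);
  cov_id : forall X x, tr X X (gid X) x = x;
  cov_comp : forall X Y Z (f : gmap Y Z) (h : gmap X Y) x,
    tr X Z (gcomp f h) x = tr Y Z f (tr X Y h x) }.

Record is_additive (M : gset gT -> nmodType)
    (res : forall X Y, gmap X Y -> M Y -> M X) : Prop := {
  add_void : forall x y : M (gvoid gT), x = y;
  add_sum : forall X Y, bijective (fun z : M (gsum X Y) =>
    (res X (gsum X Y) (ginl X Y) z, res Y (gsum X Y) (ginr X Y) z)) }.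

Record is_semiMackey (M : gset gT -> nmodType)
    (res : forall X Y, gmap X Y -> M Y -> M X)
    (tr : forall X Y, gmap X Y -> M X -> M Y) : Prop := {
  smk_contra : is_contravariant res;
  smk_cov : is_covariant tr;
  smk_pullback : forall X X' Y Y' (f : gmap Y' Y) (g : gmap X Y)
    (g' : gmap X' Y') (f' : gmap X' X), is_pullback f g g' f' ->
    forall x, res Y' Y f (tr X Y g x) = tr X' Y' g' (res X' X f' x);
  smk_add : is_additive res }.

Record addFunctor := AddFunctor {
  af_val :> gset gT -> nmodType;
  af_res : forall X Y, gmap X Y -> af_val Y -> af_val X;
  af_contra : is_contravariant af_res;
  af_add : is_additive af_res }.

Record semiMackey := SemiMackey {
  sm_val :> gset gT -> nmodType;
  sm_res : forall X Y, gmap X Y -> sm_val Y -> sm_val X;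
  sm_tr : forall X Y, gmap X Y -> sm_val X -> sm_val Y;
  sm_axioms : is_semiMackey sm_res sm_tr }.

Definition sm_contra (M : semiMackey) : addFunctor :=
  AddFunctor (smk_contra (sm_axioms M)) (smk_add (sm_axioms M)).

(* The cross product of x and y is the product in M(X * Y) of their
   restrictions along the projections, hence is part of this data. *)
Record greenData := GreenData {
  gd_val :> gset gT -> comPzRingType;
  gd_res : forall X Y, gmap X Y -> gd_val Y -> gd_val X;
  gd_tr : forall X Y, gmap X Y -> gd_val X -> gd_val Y }.

Record is_green (M : greenData) : Prop := {
  green_mackey : @is_semiMackey (fun X => gd_val M X) (@gd_res M) (@gd_tr M);
  green_res : forall X Y (f : gmap X Y), monoid_morphism (@gd_res M X Y f);
  green_frobenius : forall X Y (f : gmap X Y) x y,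
    @gd_tr M X Y f (x * @gd_res M X Y f y) = @gd_tr M X Y f x * y }.

Record green := Green {
  green_data :> greenData;
  green_axioms : is_green green_data }.

Record tambara := Tambara {
  tam_val :> gset gT -> comPzRingType;
  tam_res : forall X Y, gmap X Y -> tam_val Y -> tam_val X;
  tam_tr : forall X Y, gmap X Y -> tam_val X -> tam_val Y;
  tam_nrm : forall X Y, gmap X Y -> tam_val X -> tam_val Y;
  tam_additive : @is_semiMackey (fun X => tam_val X) tam_res tam_tr;
  tam_multiplicative :
    @is_semiMackey (fun X => multMon (tam_val X)) tam_res tam_nrm;
  tam_exponential : forall A X Y (eta : gmap X Y) (p : gmap A X) a,
    tam_tr (gpi_proj eta p)
      (tam_nrm (gpi_rho eta p) (tam_res (gpi_lambda eta p) a))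
    = tam_nrm eta (tam_tr p a) }.

(* The pair (T^*, T_+); that it satisfies [is_green] is a consequence of the
   Tambara axioms, so as a Green functor it is determined by this data. *)
Definition tam_green_data (T : tambara) : greenData :=
  GreenData (@tam_res T) (@tam_tr T).

End Functors.

(* The Grothendieck ring of a commutative semi-ring S: formal differences
   (a, b) = a - b modulo (a, b) ~ (c, d) iff a + d + k = c + b + k. *)
Section Grothendieck.
Variable S : comPzSemiRingType.
Implicit Types (a b c d : S) (x y z : S * S).

Definition groth_rel : rel (S * S) :=
  fun x y => `[< exists k, x.1 + y.2 + k = y.1 + x.2 + k >].

Lemma groth_rel_refl : reflexive groth_rel.
Proof. by move=> x; apply/asboolP; exists 0. Qed.
Lemma groth_rel_sym : symmetric groth_rel.
Proof. by move=> x y; apply/asboolP/asboolP => -[k E]; exists k. Qed.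
Lemma groth_rel_trans : transitive groth_rel.
Proof.
move=> y x z /asboolP [k E] /asboolP [l F]; apply/asboolP.
exists (y.2 + k + (y.1 + l)).
transitivity ((x.1 + y.2 + k) + (y.1 + z.2 + l)); first by ring.
by rewrite E F; ring.
Qed.
Canonical groth_equiv :=
  EquivRel groth_rel groth_rel_refl groth_rel_sym groth_rel_trans.

Definition groth : Type := {eq_quot groth_equiv}.
HB.instance Definition _ := Choice.on groth.

Definition groth_of (x : S * S) : groth := \pi_{eq_quot groth_equiv} x.
Definition groth_repr (u : groth) : S * S := generic_quotient.repr (u : {eq_quot groth_equiv}).

Lemma groth_reprK (u : groth) : groth_of (groth_repr u) = u.
Proof. exact: reprK. Qed.

Lemma groth_eq x y :
  groth_of x = groth_of y <-> exists k, x.1 + y.2 + k = y.1 + x.2 + k.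
Proof.
split=> [/eqP|E]; first by rewrite /groth_of eqmodE => /asboolP.
by apply/eqP; rewrite /groth_of eqmodE; apply/asboolP.
Qed.

Lemma groth_repr_of x :
  exists k, (groth_repr (groth_of x)).1 + x.2 + k
          = x.1 + (groth_repr (groth_of x)).2 + k.
Proof. by apply/groth_eq; rewrite groth_reprK. Qed.

Definition groth_zero : groth := groth_of (0, 0).
Definition groth_one : groth := groth_of (1, 0).
Definition groth_opp (u : groth) : groth :=
  let x := groth_repr u in groth_of (x.2, x.1).
Definition groth_add (u v : groth) : groth :=
  let x := groth_repr u in let y := groth_repr v in
  groth_of (x.1 + y.1, x.2 + y.2).
Definition groth_mul (u v : groth) : groth :=
  let x := groth_repr u in let y := groth_repr v in
  groth_of (x.1 * y.1 + x.2 * y.2, x.1 * y.2 + x.2 * y.1).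

Lemma groth_oppE x : groth_opp (groth_of x) = groth_of (x.2, x.1).
Proof.
have [k E] := groth_repr_of x; apply/groth_eq; exists k => /=.
by rewrite [_.2 + x.1]addrC -E; ring.
Qed.

Lemma groth_addE x y :
  groth_add (groth_of x) (groth_of y) = groth_of (x.1 + y.1, x.2 + y.2).
Proof.
have [k E] := groth_repr_of x; have [l F] := groth_repr_of y.
apply/groth_eq; exists (k + l) => /=.
set u := groth_repr _ in E *; set v := groth_repr _ in F *.
transitivity ((u.1 + x.2 + k) + (v.1 + y.2 + l)); first by ring.
by rewrite E F; ring.
Qed.

Lemma groth_mulE x y :
  groth_mul (groth_of x) (groth_of y)
  = groth_of (x.1 * y.1 + x.2 * y.2, x.1 * y.2 + x.2 * y.1).
Proof.
have [k E] := groth_repr_of x; have [l F] := groth_repr_of y.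
set u := groth_repr _ in E *; set v := groth_repr _ in F *.
transitivity (groth_of (u.1 * y.1 + u.2 * y.2, u.1 * y.2 + u.2 * y.1)).
  apply/groth_eq; exists (u.1 * l + u.2 * l) => /=.
  transitivity (u.1 * (v.1 + y.2 + l) + u.2 * (y.1 + v.2 + l)); first by ring.
  by rewrite F -{2}F; ring.
apply/groth_eq; exists (k * y.1 + k * y.2) => /=.
transitivity ((u.1 + x.2 + k) * y.1 + (x.1 + u.2 + k) * y.2); first by ring.
by rewrite E -{2}E; ring.
Qed.

Lemma groth_addA : associative groth_add.
Proof.
move=> u v w; rewrite -(groth_reprK u) -(groth_reprK v) -(groth_reprK w).
by rewrite !groth_addE /= !addrA.
Qed.
Lemma groth_addC : commutative groth_add.
Proof.
move=> u v; rewrite -(groth_reprK u) -(groth_reprK v).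
by rewrite !groth_addE; congr groth_of; congr pair; rewrite addrC.
Qed.
Lemma groth_add0 : left_id groth_zero groth_add.
Proof.
by move=> u; rewrite -(groth_reprK u) groth_addE /= !add0r -surjective_pairing.
Qed.
Lemma groth_addN : left_inverse groth_zero groth_opp groth_add.
Proof.
move=> u; rewrite -(groth_reprK u) groth_oppE groth_addE.
by apply/groth_eq; exists 0 => /=; ring.
Qed.
HB.instance Definition _ :=
  GRing.isZmodule.Build groth groth_addA groth_addC groth_add0 groth_addN.

Lemma groth_mulA : associative groth_mul.
Proof.
move=> u v w; rewrite -(groth_reprK u) -(groth_reprK v) -(groth_reprK w).
by rewrite !groth_mulE; congr groth_of; congr pair => /=; ring.
Qed.
Lemma groth_mulC : commutative groth_mul.
Proof.
move=> u v; rewrite -(groth_reprK u) -(groth_reprK v).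
by rewrite !groth_mulE; congr groth_of; congr pair => /=; ring.
Qed.
Lemma groth_mul1 : left_id groth_one groth_mul.
Proof.
move=> u; rewrite -(groth_reprK u) groth_mulE /= !mul1r !mul0r !addr0.
by rewrite -surjective_pairing.
Qed.
Lemma groth_mulDl : left_distributive groth_mul +%R.
Proof.
move=> u v w; rewrite -(groth_reprK u) -(groth_reprK v) -(groth_reprK w).
rewrite -[RHS]/(groth_add _ _) -[X in groth_mul X]/(groth_add _ _).
rewrite !(groth_mulE, groth_addE) /=.
by congr groth_of; congr pair; ring.
Qed.
HB.instance Definition _ := GRing.Zmodule_isComPzRing.Build groth
  groth_mulA groth_mulC groth_mul1 groth_mulDl.

Definition groth_in a : groth := groth_of (a, 0).

Lemma groth_in_nmod : nmod_morphism groth_in.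
Proof.
split=> // a b; rewrite -[RHS]/(groth_add _ _) groth_addE /=.
by rewrite addr0.
Qed.

Lemma groth_in_monoid : monoid_morphism groth_in.
Proof.
split=> // a b; rewrite -[RHS]/(groth_mul _ _) groth_mulE /=.
by rewrite !mulr0 !mul0r !addr0.
Qed.

Lemma groth_ofE x : groth_of x = groth_in x.1 - groth_in x.2.
Proof.
rewrite -[RHS]/(groth_add _ (groth_opp _)) groth_oppE groth_addE /=.
by rewrite addr0 add0r -surjective_pairing.
Qed.

Lemma groth_ind (P : groth -> Prop) :
  (forall a b, P (groth_in a - groth_in b)) -> forall u, P u.
Proof. by move=> H u; rewrite -(groth_reprK u) groth_ofE. Qed.

End Grothendieck.

(* The homomorphism of Grothendieck groups induced by an additive f. *)
Definition groth_map (S S' : comPzSemiRingType) (f : S -> S')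
  (u : groth S) : groth S' :=
  groth_in (f (groth_repr u).1) - groth_in (f (groth_repr u).2).

Section GrothMap.
Variables (S S' : comPzSemiRingType) (f : S -> S').
Hypothesis f_add : nmod_morphism f.

Lemma groth_map_ofE x : groth_map f (groth_of x) = groth_of (f x.1, f x.2).
Proof.
rewrite /groth_map -[LHS](groth_ofE (_, _)); apply/groth_eq => /=.
by have [k /(congr1 f)] := groth_repr_of x; rewrite !f_add.2; exists (f k).
Qed.

Lemma groth_map_in a : groth_map f (groth_in a) = groth_in (f a).
Proof. by rewrite groth_map_ofE /= f_add.1. Qed.

Lemma groth_map_zmod : zmod_morphism (groth_map f).
Proof.
move=> u v; rewrite -(groth_reprK u) -(groth_reprK v).
rewrite -[X in groth_map f X]/(groth_add _ (groth_opp _)).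
rewrite -[RHS]/(groth_add _ (groth_opp _)).
by rewrite !(groth_map_ofE, groth_oppE, groth_addE) /= !f_add.2.
Qed.

Lemma groth_map_nmod : nmod_morphism (groth_map f).
Proof.
have H0 : groth_map f 0 = 0 by rewrite -[0](subrr 0) groth_map_zmod !subrr.
split=> // u v; rewrite -[v]opprK groth_map_zmod -[in RHS]sub0r.
by rewrite groth_map_zmod H0 sub0r.
Qed.

Lemma groth_map_sub a b :
  groth_map f (groth_in a - groth_in b) = groth_in (f a) - groth_in (f b).
Proof. by rewrite groth_map_zmod !groth_map_in. Qed.

Lemma groth_map_monoid : monoid_morphism f -> monoid_morphism (groth_map f).
Proof.
move=> f_mul; split=> [|u v].
  by rewrite -[1](groth_in_monoid S).1 groth_map_in f_mul.1.
rewrite -(groth_reprK u) -(groth_reprK v).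
rewrite -[X in groth_map f X]/(groth_mul _ _) -[RHS]/(groth_mul _ _).
by rewrite !(groth_map_ofE, groth_mulE) /= !f_add.2 !f_mul.2.
Qed.

End GrothMap.

Section Burnside.
Variables (gT : finGroupType) (F : addFunctor gT).
Implicit Types X Y Z A B : gset gT.

Lemma af_res0 X Y (f : gmap X Y) : af_res f (0 : F Y) = 0.
Proof. exact: (contra_mor (af_contra F) f).1. Qed.
Lemma af_resD X Y (f : gmap X Y) (m n : F Y) :
  af_res f (m + n) = af_res f m + af_res f n.
Proof. exact: (contra_mor (af_contra F) f).2. Qed.
Lemma af_res_id X (f : gmap X X) (m : F X) : f =1 id -> af_res f m = m.
Proof.
by move=> E; rewrite (_ : f = gid X) ?(contra_id (af_contra F)) //; exact: gmap_eq.
Qed.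
Lemma af_resE X Y (f h : gmap X Y) (m : F Y) : f =1 h -> af_res f m = af_res h m.
Proof. by move/gmap_eq->. Qed.
Lemma af_res_res X Y Z (f : gmap Y Z) (g : gmap X Y) (h : gmap X Z) (m : F Z) :
  f \o g =1 h -> af_res g (af_res f m) = af_res h m.
Proof.
move=> E; rewrite -(contra_comp (af_contra F)).
by apply: af_resE.
Qed.

Lemma af_sum_inj A B (m n : F (gsum A B)) :
  af_res (ginl A B) m = af_res (ginl A B) n ->
  af_res (ginr A B) m = af_res (ginr A B) n -> m = n.
Proof.
move=> El Er; apply: (bij_inj (add_sum (af_add F) A B)).
by rewrite El Er.
Qed.

Lemma af_glue_ex A B (m : F A) (n : F B) : exists l : F (gsum A B),
  af_res (ginl A B) l = m /\ af_res (ginr A B) l = n.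
Proof. by case: (add_sum (af_add F) A B) => s _ /(_ (m, n)) [E1 E2]; exists (s (m, n)). Qed.

Lemma af_comp X Y Z (f : gmap Y Z) (g : gmap X Y) (m : F Z) :
  af_res (gcomp f g) m = af_res g (af_res f m).
Proof. by rewrite (af_res_res (h := gcomp f g)). Qed.
Lemma af_casel A B X (f : gmap A X) (g : gmap B X) (m : F X) :
  af_res (ginl A B) (af_res (gcase f g) m) = af_res f m.
Proof. exact: af_res_res. Qed.
Lemma af_caser A B X (f : gmap A X) (g : gmap B X) (m : F X) :
  af_res (ginr A B) (af_res (gcase f g) m) = af_res g m.
Proof. exact: af_res_res. Qed.
Lemma af_lift1 X Y Z W (f : gmap X Z) (h : gmap Y Z) (a : gmap W X)
    (b : gmap W Y) (e : forall w, f (a w) = h (b w)) (m : F X) :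
  af_res (gpb_lift e) (af_res (gpb1 f h) m) = af_res a m.
Proof. exact: af_res_res. Qed.
Lemma af_lift2 X Y Z W (f : gmap X Z) (h : gmap Y Z) (a : gmap W X)
    (b : gmap W Y) (e : forall w, f (a w) = h (b w)) (m : F Y) :
  af_res (gpb_lift e) (af_res (gpb2 f h) m) = af_res b m.
Proof. exact: af_res_res. Qed.
Lemma af_void_eq (m n : F (gvoid gT)) : m = n.
Proof. exact: (add_void (af_add F)). Qed.

(* The label on A + B corresponding to (m, n) under F(A + B) = F(A) * F(B). *)
Definition af_glue A B (m : F A) (n : F B) : F (gsum A B) :=
  sval (cid (af_glue_ex m n)).

Lemma af_gluel A B (m : F A) (n : F B) : af_res (ginl A B) (af_glue m n) = m.
Proof. by rewrite /af_glue; case: cid => l []. Qed.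
Lemma af_gluer A B (m : F A) (n : F B) : af_res (ginr A B) (af_glue m n) = n.
Proof. by rewrite /af_glue; case: cid => l []. Qed.

Definition af_simp := (af_gluel, af_gluer, af_casel, af_caser, af_lift1,
  af_lift2, af_comp, af_resD, af_res0).

Section Objects.
Variable X : gset gT.

Record bobj := BObj {
  bdom : gset gT;
  bmap : gmap bdom X;
  blab : F bdom }.

Record bhom (a b : bobj) := BHom {
  bhom_map :> gmap (bdom a) (bdom b);
  bhom_over : gcomp (bmap b) bhom_map = bmap a;
  bhom_lab : af_res bhom_map (blab b) = blab a }.

Lemma bhom_overE a b (f : bhom a b) x : bmap b (f x) = bmap a x.
Proof. by rewrite -[RHS](congr1 (fun h => gmap_fun h x) (bhom_over f)). Qed.

Definition biso (a b : bobj) : Prop :=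
  exists (f : bhom a b) (g : bhom b a), cancel f g /\ cancel g f.

Lemma biso_refl a : biso a a.
Proof.
have H : gcomp (bmap a) (gid (bdom a)) = bmap a by exact: gmap_eq.
have K : af_res (gid (bdom a)) (blab a) = blab a by exact: af_res_id.
by exists (BHom H K), (BHom H K).
Qed.

Lemma biso_sym a b : biso a b -> biso b a.
Proof. by case=> f [g [fK gK]]; exists g, f. Qed.

Lemma biso_trans b a c : biso a b -> biso b c -> biso a c.
Proof.
have comp x y z (f : bhom x y) (g : bhom y z) :
  exists h : bhom x z, h =1 g \o f.
  have H : gcomp (bmap z) (gcomp g f) = bmap x.
    rewrite -(bhom_over f) -(bhom_over g); exact: gmap_eq.
  have K : af_res (gcomp g f) (blab z) = blab x.
    by rewrite -(bhom_lab f) -(bhom_lab g) af_comp.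
  by exists (BHom H K).
case=> f [f' [fK f'K]] [g [g' [gK g'K]]].
have [h hE] := comp _ _ _ f g; have [k kE] := comp _ _ _ g' f'.
exists h, k; split=> x; rewrite hE kE /=; first by rewrite gK fK.
by rewrite f'K g'K.
Qed.

Lemma bisoI a b (f : gmap (bdom a) (bdom b)) (g : bdom b -> bdom a) :
  cancel f g -> cancel g f ->
  (forall x, bmap b (f x) = bmap a x) -> af_res f (blab b) = blab a -> biso a b.
Proof.
move=> fK gK fo fl.
have gE x h : g (x ⋅ h) = g x ⋅ h.
  by apply: (can_inj fK); rewrite gK gmap_equiv gK.
have H1 : gcomp (bmap b) f = bmap a by exact: gmap_eq.
have H2 : gcomp (bmap a) (GMap gE) = bmap b.
  by apply: gmap_eq => x /=; rewrite -fo gK.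
have H3 : af_res (GMap gE) (blab a) = blab b.
  by rewrite -fl (af_res_res (h := gid _)) ?af_res_id.
by exists (BHom H1 fl), (BHom H2 H3).
Qed.

Lemma biso_bij a b (f : gmap (bdom a) (bdom b)) :
  injective f -> (forall y, exists x, f x = y) ->
  (forall x, bmap b (f x) = bmap a x) -> af_res f (blab b) = blab a -> biso a b.
Proof.
move=> fi fs; pose g y := sval (cid (fs y)).
have gK : cancel g f by move=> y; rewrite /g; case: cid.
move=> fo fl; have fK : cancel f g by move=> x; apply: fi; rewrite gK.
exact: bisoI fK gK fo fl.
Qed.

HB.instance Definition _ := gen_eqMixin bobj.
HB.instance Definition _ := gen_choiceMixin bobj.

Definition biso_rel : rel bobj := fun a b => `[< biso a b >].
Lemma biso_rel_refl : reflexive biso_rel.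
Proof. by move=> a; apply/asboolP/biso_refl. Qed.
Lemma biso_rel_sym : symmetric biso_rel.
Proof. by move=> a b; apply/asboolP/asboolP => /biso_sym. Qed.
Lemma biso_rel_trans : transitive biso_rel.
Proof.
by move=> b a c /asboolP ab /asboolP bc; apply/asboolP/(biso_trans ab bc).
Qed.
Canonical biso_equiv :=
  EquivRel biso_rel biso_rel_refl biso_rel_sym biso_rel_trans.

Definition bcls : Type := {eq_quot biso_equiv}.
HB.instance Definition _ := Choice.on bcls.

Definition bcls_of (a : bobj) : bcls := \pi_{eq_quot biso_equiv} a.
Definition bcls_repr (u : bcls) : bobj :=
  generic_quotient.repr (u : {eq_quot biso_equiv}).

Lemma bcls_reprK u : bcls_of (bcls_repr u) = u.
Proof. exact: reprK. Qed.
Lemma bcls_eq a b : bcls_of a = bcls_of b <-> biso a b.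
Proof.
split=> [/eqP|E]; first by rewrite /bcls_of eqmodE => /asboolP.
by apply/eqP; rewrite /bcls_of eqmodE; apply/asboolP.
Qed.
Lemma bcls_repr_of a : biso (bcls_repr (bcls_of a)) a.
Proof. by apply/bcls_eq; rewrite bcls_reprK. Qed.

(* The product of labels is taken in the monoid F, hence written with +. *)
Definition bzero : bobj := BObj (gvoid_map X) 0.
Definition bone : bobj := BObj (gid X) 0.
Definition bsum (a b : bobj) : bobj :=
  BObj (gcase (bmap a) (bmap b)) (af_glue (blab a) (blab b)).
Definition bprod (a b : bobj) : bobj :=
  BObj (gcomp (bmap a) (gpb1 (bmap a) (bmap b)))
       (af_res (gpb1 (bmap a) (bmap b)) (blab a)
        + af_res (gpb2 (bmap a) (bmap b)) (blab b)).

Lemma bsum_iso a a' b b' : biso a a' -> biso b b' -> biso (bsum a b) (bsum a' b').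
Proof.
case=> f [f' [fK f'K]] [g [g' [gK g'K]]].
apply: (@biso_bij _ _ (gcase (gcomp (ginl _ _) f) (gcomp (ginr _ _) g)
  : gmap (bdom (bsum a b)) (bdom (bsum a' b')))).
- move=> [x|x] [y|y] //= [] E; first by rewrite (can_inj fK E).
  by rewrite (can_inj gK E).
- by case=> y; [exists (inl (f' y)) | exists (inr (g' y))]; rewrite /= ?f'K ?g'K.
- by case=> x /=; rewrite bhom_overE.
- by apply: af_sum_inj; rewrite /= !af_simp ?bhom_lab.
Qed.

Lemma bprod_iso a a' b b' :
  biso a a' -> biso b b' -> biso (bprod a b) (bprod a' b').
Proof.
case=> f [f' [fK f'K]] [g [g' [gK g'K]]].
have e (w : gpb (bmap a) (bmap b)) :
    bmap a' (gcomp f (gpb1 _ _) w) = bmap b' (gcomp g (gpb2 _ _) w).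
  by rewrite /= !bhom_overE gpbP.
apply: (@biso_bij _ _ (gpb_lift e : gmap (bdom (bprod a b)) (bdom (bprod a' b')))).
- by move=> u v [] /(can_inj fK) E1 /(can_inj gK) E2; exact: gpb_ext.
- move=> u; have E : bmap a (f' (gpb1 _ _ u)) = bmap b (g' (gpb2 _ _ u)).
    by rewrite !bhom_overE gpbP.
  by exists (gpb_mk E); apply: gpb_ext; rewrite /= ?f'K ?g'K.
- by move=> u /=; rewrite bhom_overE.
- by rewrite /= !af_simp !bhom_lab.
Qed.

Lemma bsumC a b : biso (bsum a b) (bsum b a).
Proof.
apply: (@biso_bij _ _ (gcase (ginr _ _) (ginl _ _)
  : gmap (bdom (bsum a b)) (bdom (bsum b a)))).
- by move=> [x|x] [y|y] //= [->].
- by case=> x; [exists (inr x) | exists (inl x)].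
- by case.
- by apply: af_sum_inj; rewrite /= !af_simp.
Qed.

Lemma bsumA a b c : biso (bsum a (bsum b c)) (bsum (bsum a b) c).
Proof.
apply: (@biso_bij _ _ (gcase (gcomp (ginl _ _) (ginl _ _))
    (gcase (gcomp (ginl _ _) (ginr _ _)) (ginr _ _))
  : gmap (bdom (bsum a (bsum b c))) (bdom (bsum (bsum a b) c)))).
- by move=> [x|[x|x]] [y|[y|y]] //= [->].
- by case=> [[x|x]|x]; [exists (inl x) | exists (inr (inl x)) | exists (inr (inr x))].
- by case=> [x|[x|x]].
- apply: af_sum_inj; first by rewrite /= !af_simp.
  by rewrite !af_simp; apply: af_sum_inj; rewrite /= !af_simp.
Qed.

Lemma bsum0 a : biso (bsum bzero a) a.
Proof.
apply: (@biso_bij _ _ (gcase (gvoid_map _) (gid _)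
  : gmap (bdom (bsum bzero a)) (bdom a))).
- by move=> [[]|x] [[]|y] //= ->.
- by move=> x; exists (inr x).
- by case.
- apply: af_sum_inj; first exact: af_void_eq.
  by rewrite /= !af_simp af_res_id.
Qed.

Lemma bprodC a b : biso (bprod a b) (bprod b a).
Proof.
have e (w : gpb (bmap a) (bmap b)) : bmap b (gpb2 _ _ w) = bmap a (gpb1 _ _ w).
  by rewrite gpbP.
apply: (@biso_bij _ _ (gpb_lift e : gmap (bdom (bprod a b)) (bdom (bprod b a)))).
- by move=> u v [] E1 E2; exact: gpb_ext.
- by move=> u; exists (gpb_mk (esym (gpbP u))); exact: gpb_ext.
- by move=> u /=; exact: e.
- by rewrite /= !af_simp addrC.
Qed.

Lemma bprodA a b c : biso (bprod a (bprod b c)) (bprod (bprod a b) c).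
Proof.
have e (w : gpb (bmap a) (bmap (bprod b c))) :
  bmap a (gpb1 _ _ w) = bmap b (gcomp (gpb1 _ _) (gpb2 _ _) w) by exact: gpbP.
have e' (w : gpb (bmap a) (bmap (bprod b c))) :
    bmap (bprod a b) (gpb_lift e w) = bmap c (gcomp (gpb2 _ _) (gpb2 _ _) w).
  exact: etrans (gpbP w) (gpbP (gpb2 _ _ w)).
apply: (@biso_bij _ _ (gpb_lift e'
  : gmap (bdom (bprod a (bprod b c))) (bdom (bprod (bprod a b) c)))).
- by move=> u v [] E1 E2 E3; apply: gpb_ext => //; exact: gpb_ext.
- move=> u; pose v := gpb1 _ _ u.
  have E1 : bmap b (gpb2 _ _ v) = bmap c (gpb2 _ _ u).
    exact: etrans (esym (gpbP v)) (gpbP u).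
  have E2 : bmap a (gpb1 _ _ v) = bmap (bprod b c) (gpb_mk E1) by exact: gpbP v.
  by exists (gpb_mk E2); apply: gpb_ext => //; exact: gpb_ext.
- by [].
- by rewrite /= !af_simp addrA.
Qed.

Lemma bprod1 a : biso (bprod bone a) a.
Proof.
apply: (@biso_bij _ _ (gpb2 _ _ : gmap (bdom (bprod bone a)) (bdom a))).
- by move=> u v E; apply: gpb_ext => //; move: (gpbP u) (gpbP v); rewrite E /= => -> ->.
- by move=> x; exists (@gpb_mk _ _ _ _ (gid X) (bmap a) (bmap a x) x erefl).
- by move=> u; rewrite -gpbP.
- by rewrite /= af_res0 add0r.
Qed.

Lemma bprodDl a b c :
  biso (bprod (bsum a b) c) (bsum (bprod a c) (bprod b c)).
Proof.
apply: biso_sym.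
have e1 (w : gpb (bmap a) (bmap c)) :
    bmap (bsum a b) (gcomp (ginl _ _) (gpb1 _ _) w) = bmap c (gpb2 _ _ w).
  exact: gpbP.
have e2 (w : gpb (bmap b) (bmap c)) :
    bmap (bsum a b) (gcomp (ginr _ _) (gpb1 _ _) w) = bmap c (gpb2 _ _ w).
  exact: gpbP.
apply: (@biso_bij _ _ (gcase (gpb_lift e1) (gpb_lift e2)
  : gmap (bdom (bsum (bprod a c) (bprod b c))) (bdom (bprod (bsum a b) c)))).
- by move=> [u|u] [v|v] //= [] E1 E2; congr (_ _); exact: gpb_ext.
- move=> u; have := gpbP u; case E: (gpb1 _ _ u) => [x|x] /= h.
    by exists (inl (gpb_mk h)); apply: gpb_ext.
  by exists (inr (gpb_mk h)); apply: gpb_ext.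
- by case.
- by apply: af_sum_inj; rewrite /= !af_simp.
Qed.

Lemma bprod0 a : biso (bprod bzero a) bzero.
Proof.
apply: biso_sym.
apply: (@biso_bij _ _ (gvoid_map _
  : gmap (bdom bzero) (bdom (bprod bzero a)))).
- by case.
- by move=> u; case: (gpb1 _ _ u).
- by case.
- exact: af_void_eq.
Qed.

Definition bcls_add (u v : bcls) : bcls := bcls_of (bsum (bcls_repr u) (bcls_repr v)).
Definition bcls_mul (u v : bcls) : bcls := bcls_of (bprod (bcls_repr u) (bcls_repr v)).

Lemma bcls_addE a b : bcls_add (bcls_of a) (bcls_of b) = bcls_of (bsum a b).
Proof. by apply/bcls_eq/bsum_iso; exact: bcls_repr_of. Qed.
Lemma bcls_mulE a b : bcls_mul (bcls_of a) (bcls_of b) = bcls_of (bprod a b).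
Proof. by apply/bcls_eq/bprod_iso; exact: bcls_repr_of. Qed.

Lemma bcls_addA : associative bcls_add.
Proof.
move=> u v w; rewrite -(bcls_reprK u) -(bcls_reprK v) -(bcls_reprK w).
by rewrite !bcls_addE; exact/bcls_eq/bsumA.
Qed.
Lemma bcls_addC : commutative bcls_add.
Proof.
move=> u v; rewrite -(bcls_reprK u) -(bcls_reprK v) !bcls_addE.
exact/bcls_eq/bsumC.
Qed.
Lemma bcls_add0 : left_id (bcls_of bzero) bcls_add.
Proof. by move=> u; rewrite -(bcls_reprK u) bcls_addE; exact/bcls_eq/bsum0. Qed.
HB.instance Definition _ :=
  GRing.isNmodule.Build bcls bcls_addA bcls_addC bcls_add0.

Lemma bcls_mulA : associative bcls_mul.
Proof.
move=> u v w; rewrite -(bcls_reprK u) -(bcls_reprK v) -(bcls_reprK w).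
by rewrite !bcls_mulE; exact/bcls_eq/bprodA.
Qed.
Lemma bcls_mulC : commutative bcls_mul.
Proof.
move=> u v; rewrite -(bcls_reprK u) -(bcls_reprK v) !bcls_mulE.
exact/bcls_eq/bprodC.
Qed.
Lemma bcls_mul1 : left_id (bcls_of bone) bcls_mul.
Proof. by move=> u; rewrite -(bcls_reprK u) bcls_mulE; exact/bcls_eq/bprod1. Qed.
Lemma bcls_mulDl : left_distributive bcls_mul +%R.
Proof.
move=> u v w; rewrite -(bcls_reprK u) -(bcls_reprK v) -(bcls_reprK w).
rewrite -[RHS]/(bcls_add _ _) -[X in bcls_mul X]/(bcls_add _ _).
by rewrite !(bcls_mulE, bcls_addE); exact/bcls_eq/bprodDl.
Qed.
Lemma bcls_mul0 : left_zero 0 bcls_mul.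
Proof.
by move=> u; rewrite -(bcls_reprK u) [LHS]bcls_mulE; exact/bcls_eq/bprod0.
Qed.
HB.instance Definition _ := GRing.Nmodule_isComPzSemiRing.Build bcls
  bcls_mulA bcls_mulC bcls_mul1 bcls_mulDl bcls_mul0.

Lemma bcls_ofD a b : bcls_of a + bcls_of b = bcls_of (bsum a b).
Proof. exact: bcls_addE. Qed.
Lemma bcls_ofM a b : bcls_of a * bcls_of b = bcls_of (bprod a b).
Proof. exact: bcls_mulE. Qed.
Lemma bcls_ind (P : bcls -> Prop) : (forall a, P (bcls_of a)) -> forall u, P u.
Proof. by move=> H u; rewrite -(bcls_reprK u). Qed.

End Objects.
End Burnside.

Section BurnsideGreen.
Variables (gT : finGroupType) (F : addFunctor gT).
Implicit Types X Y Z A B : gset gT.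

Definition bres X Y (z : gmap Y X) (a : bobj F X) : bobj F Y :=
  BObj (gpb2 (bmap a) z) (af_res (gpb1 (bmap a) z) (blab a)).
Definition btr X Y (xi : gmap X Y) (a : bobj F X) : bobj F Y :=
  BObj (gcomp xi (bmap a)) (blab a).

Section Res.
Variables (X Y : gset gT) (z : gmap Y X).
Implicit Types a b : bobj F X.

Lemma bres_iso a b : biso a b -> biso (bres z a) (bres z b).
Proof.
case=> f [f' [fK f'K]].
have e (w : gpb (bmap a) z) : bmap b (gcomp f (gpb1 _ _) w) = z (gpb2 _ _ w).
  by rewrite /= bhom_overE gpbP.
apply: (@biso_bij _ _ _ _ _ (gpb_lift e : gmap (bdom (bres z a)) (bdom (bres z b)))).
- by move=> u v [] /(can_inj fK) E1 E2; exact: gpb_ext.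
- move=> u; have E : bmap a (f' (gpb1 _ _ u)) = z (gpb2 _ _ u).
    by rewrite bhom_overE gpbP.
  by exists (gpb_mk E); apply: gpb_ext; rewrite /= ?f'K.
- by [].
- by rewrite /= !af_simp bhom_lab.
Qed.

Lemma bres_zero : biso (bres z (bzero F X)) (bzero F Y).
Proof.
apply: biso_sym; apply: (@biso_bij _ _ _ _ _ (gvoid_map _
  : gmap (bdom (bzero F Y)) (bdom (bres z (bzero F X))))).
- by case.
- by move=> u; case: (gpb1 _ _ u).
- by case.
- exact: af_void_eq.
Qed.

Lemma bres_one : biso (bres z (bone F X)) (bone F Y).
Proof.
apply: (@biso_bij _ _ _ _ _ (gpb2 _ _
  : gmap (bdom (bres z (bone F X))) (bdom (bone F Y)))).
- by move=> u v E; apply: gpb_ext => //; move: (gpbP u) (gpbP v); rewrite E /= => -> ->.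
- by move=> y; exists (@gpb_mk _ _ _ _ (gid X) z (z y) y erefl).
- by [].
- by rewrite /= !af_res0.
Qed.

Lemma bres_sum a b : biso (bres z (bsum a b)) (bsum (bres z a) (bres z b)).
Proof.
apply: biso_sym.
have e1 (w : gpb (bmap a) z) :
  bmap (bsum a b) (gcomp (ginl _ _) (gpb1 _ _) w) = z (gpb2 _ _ w) by exact: gpbP w.
have e2 (w : gpb (bmap b) z) :
  bmap (bsum a b) (gcomp (ginr _ _) (gpb1 _ _) w) = z (gpb2 _ _ w) by exact: gpbP w.
apply: (@biso_bij _ _ _ _ _ (gcase (gpb_lift e1) (gpb_lift e2)
  : gmap (bdom (bsum (bres z a) (bres z b))) (bdom (bres z (bsum a b))))).
- by move=> [u|u] [v|v] //= [] E1 E2; congr (_ _); exact: gpb_ext.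
- move=> u; have := gpbP u; case E: (gpb1 _ _ u) => [x|x] /= h.
    by exists (inl (gpb_mk h)); apply: gpb_ext.
  by exists (inr (gpb_mk h)); apply: gpb_ext.
- by case.
- by apply: af_sum_inj; rewrite /= !af_simp.
Qed.

Lemma bres_prod a b : biso (bres z (bprod a b)) (bprod (bres z a) (bres z b)).
Proof.
have e1 (w : gpb (bmap (bprod a b)) z) :
  bmap a (gcomp (gpb1 _ _) (gpb1 _ _) w) = z (gpb2 _ _ w) by exact: gpbP w.
have e2 (w : gpb (bmap (bprod a b)) z) :
    bmap b (gcomp (gpb2 _ _) (gpb1 _ _) w) = z (gpb2 _ _ w).
  exact: etrans (esym (gpbP (gpb1 _ _ w))) (gpbP w).
have e (w : gpb (bmap (bprod a b)) z) :
  bmap (bres z a) (gpb_lift e1 w) = bmap (bres z b) (gpb_lift e2 w) by [].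
apply: (@biso_bij _ _ _ _ _ (gpb_lift e
  : gmap (bdom (bres z (bprod a b))) (bdom (bprod (bres z a) (bres z b))))).
- by move=> u v [] E1 E2 E3 _; apply: gpb_ext => //; exact: gpb_ext.
- move=> u; pose v := gpb1 _ _ u; pose w := gpb2 _ _ u.
  have Ey : gpb2 _ _ v = gpb2 _ _ w by exact: gpbP u.
  have E1 : bmap a (gpb1 _ _ v) = bmap b (gpb1 _ _ w).
    by rewrite (gpbP v) (gpbP w) Ey.
  have E2 : bmap (bprod a b) (gpb_mk E1) = z (gpb2 _ _ v) by exact: gpbP v.
  by exists (gpb_mk E2); apply: gpb_ext; exact: gpb_ext.
- by [].
- by rewrite /= !af_simp.
Qed.
End Res.

Lemma bres_id X (a : bobj F X) : biso (bres (gid X) a) a.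
Proof.
apply: (@biso_bij _ _ _ _ _ (gpb1 _ _ : gmap (bdom (bres (gid X) a)) (bdom a))).
- move=> u v E; apply: gpb_ext => //.
  exact: etrans (esym (gpbP u)) (etrans (congr1 _ E) (gpbP v)).
- by move=> x; exists (@gpb_mk _ _ _ _ (bmap a) (gid X) x (bmap a x) erefl).
- by move=> u; exact: gpbP u.
- by [].
Qed.

Lemma bres_comp X Y Z (f : gmap Y Z) (h : gmap X Y) (a : bobj F Z) :
  biso (bres (gcomp f h) a) (bres h (bres f a)).
Proof.
have e1 (w : gpb (bmap a) (gcomp f h)) :
  bmap a (gpb1 _ _ w) = f (gcomp h (gpb2 _ _) w) by exact: gpbP.
have e (w : gpb (bmap a) (gcomp f h)) :
  bmap (bres f a) (gpb_lift e1 w) = h (gpb2 _ _ w) by [].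
apply: (@biso_bij _ _ _ _ _ (gpb_lift e
  : gmap (bdom (bres (gcomp f h) a)) (bdom (bres h (bres f a))))).
- by move=> u v [] E1 _ E2; apply: gpb_ext.
- move=> u; pose v := gpb1 _ _ u.
  have E : bmap a (gpb1 _ _ v) = gcomp f h (gpb2 _ _ u).
    by rewrite (gpbP v); congr (f _); exact: gpbP u.
  exists (gpb_mk E); apply: gpb_ext => //; apply: gpb_ext => //.
  exact/esym/(gpbP u).
- by [].
- by rewrite /= !af_simp.
Qed.

Lemma btr_iso X Y (xi : gmap X Y) (a b : bobj F X) :
  biso a b -> biso (btr xi a) (btr xi b).
Proof.
case=> f [f' [fK f'K]].
apply: (@bisoI _ _ _ (btr xi a) (btr xi b) f f') => //; last exact: bhom_lab f.
by move=> x /=; rewrite bhom_overE.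
Qed.

Lemma btr_zero X Y (xi : gmap X Y) : biso (btr xi (bzero F X)) (bzero F Y).
Proof.
by apply: (@bisoI _ _ _ (btr xi (bzero F X)) (bzero F Y) (gid _) id) => //=;
  first [by case | exact: af_void_eq].
Qed.

Lemma btr_sum X Y (xi : gmap X Y) (a b : bobj F X) :
  biso (btr xi (bsum a b)) (bsum (btr xi a) (btr xi b)).
Proof.
apply: (@bisoI _ _ _ (btr xi (bsum a b)) (bsum (btr xi a) (btr xi b)) (gid _) id) => //=.
  by case.
by rewrite af_res_id.
Qed.

Lemma btr_id X (a : bobj F X) : biso (btr (gid X) a) a.
Proof.
by apply: (@bisoI _ _ _ (btr (gid X) a) a (gid _) id) => //=; rewrite af_res_id.
Qed.

Lemma btr_comp X Y Z (f : gmap Y Z) (h : gmap X Y) (a : bobj F X) :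
  biso (btr (gcomp f h) a) (btr f (btr h a)).
Proof.
apply: (@bisoI _ _ _ (btr (gcomp f h) a) (btr f (btr h a)) (gid _) id) => //=.
by rewrite af_res_id.
Qed.

Lemma is_pullback_ex X X' Y Y' (f : gmap Y' Y) (g : gmap X Y)
    (g' : gmap X' Y') (f' : gmap X' X) : is_pullback f g g' f' ->
  (forall x', g (f' x') = f (g' x')) /\
  exists u : gmap (gpb g f) X',
    [/\ forall w, f' (u w) = gpb1 _ _ w, forall w, g' (u w) = gpb2 _ _ w &
        forall x' (e : g (f' x') = f (g' x')), u (gpb_mk e) = x'].
Proof.
case=> comm univ.
have commE x' : g (f' x') = f (g' x').
  exact: (congr1 (fun h => gmap_fun h x') comm).
split=> //.
have [|u [[E1 E2] _]] := univ _ (gpb1 g f) (gpb2 g f).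
  by apply: gmap_eq => w /=; exact: gpbP.
exists u; split=> [w|w|x' e].
- exact: (congr1 (fun h => gmap_fun h w) E1).
- exact: (congr1 (fun h => gmap_fun h w) E2).
have [|v [_ uniq_v]] := univ _ f' g'; first exact: gmap_eq.
have vid : v = gid X' by apply: uniq_v; split; exact: gmap_eq.
have E : v = gcomp u (gpb_lift commE).
  apply: uniq_v; split; apply: gmap_eq => w /=.
    exact: (congr1 (fun h => gmap_fun h (gpb_lift commE w)) E1).
  exact: (congr1 (fun h => gmap_fun h (gpb_lift commE w)) E2).
have Ex : u (gpb_lift commE x') = x'.
  exact: (congr1 (fun h => gmap_fun h x') (etrans (esym E) vid)).
by rewrite -[RHS]Ex; congr (u _); apply: gpb_ext.
Qed.

Lemma bmackey X X' Y Y' (f : gmap Y' Y) (g : gmap X Y)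
    (g' : gmap X' Y') (f' : gmap X' X) (a : bobj F X) :
  is_pullback f g g' f' -> biso (bres f (btr g a)) (btr g' (bres f' a)).
Proof.
move/is_pullback_ex => [comm [u [u1 u2 uK]]].
apply: biso_sym.
have e (w : gpb (bmap a) f') :
    bmap (btr g a) (gpb1 _ _ w) = f (gcomp g' (gpb2 _ _) w).
  by rewrite /= -comm; congr (g _); exact: gpbP w.
apply: (@biso_bij _ _ _ _ _ (gpb_lift e
  : gmap (bdom (btr g' (bres f' a))) (bdom (bres f (btr g a))))).
- move=> v w [] E1 E2; apply: gpb_ext => //.
  rewrite -[LHS](uK _ (comm _)) -[RHS](uK _ (comm _)); congr (u _).
  apply: gpb_ext => //=; move: (gpbP v) (gpbP w) => /= <- <-; exact: congr1.
- move=> v; have E : g (bmap a (gpb1 _ _ v)) = f (gpb2 _ _ v) by exact: gpbP v.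
  have E' : bmap a (gpb1 _ _ v) = f' (u (gpb_mk E)) by rewrite u1.
  by exists (gpb_mk E'); apply: gpb_ext => //=; rewrite u2.
- by [].
- by rewrite /= !af_simp.
Qed.

Lemma bfrobenius X Y (f : gmap X Y) (a : bobj F X) (b : bobj F Y) :
  biso (btr f (bprod a (bres f b))) (bprod (btr f a) b).
Proof.
have e (w : gpb (bmap a) (bmap (bres f b))) :
    bmap (btr f a) (gpb1 _ _ w) = bmap b (gcomp (gpb1 _ _) (gpb2 _ _) w).
  rewrite /= (gpbP w); exact/esym/(gpbP (gpb2 _ _ w)).
apply: (@biso_bij _ _ _ _ _ (gpb_lift e
  : gmap (bdom (btr f (bprod a (bres f b)))) (bdom (bprod (btr f a) b)))).
- move=> v w [] E1 E2; apply: gpb_ext => //; apply: gpb_ext => //.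
  exact: etrans (esym (gpbP v)) (etrans (congr1 _ E1) (gpbP w)).
- move=> v; have E : bmap b (gpb2 _ _ v) = f (bmap a (gpb1 _ _ v)).
    exact/esym/(gpbP v).
  have E' : bmap a (gpb1 _ _ v) = bmap (bres f b) (gpb_mk E) by [].
  by exists (gpb_mk E'); apply: gpb_ext.
- by [].
- by rewrite /= !af_simp.
Qed.

Lemma bvoid (a : bobj F (gvoid gT)) : biso a (bzero F (gvoid gT)).
Proof.
apply: biso_sym; apply: (@biso_bij _ _ _ _ _ (gvoid_map _
  : gmap (bdom (bzero F (gvoid gT))) (bdom a))).
- by case.
- by move=> x; case: (bmap a x).
- by case.
- exact: af_void_eq.
Qed.

Lemma bsplit X Y (a : bobj F (gsum X Y)) :
  biso (bsum (btr (ginl X Y) (bres (ginl X Y) a))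
             (btr (ginr X Y) (bres (ginr X Y) a))) a.
Proof.
apply: (@biso_bij _ _ _ _ _ (gcase (gpb1 _ _) (gpb1 _ _)
  : gmap (bdom (bsum (btr (ginl X Y) (bres (ginl X Y) a))
             (btr (ginr X Y) (bres (ginr X Y) a)))) (bdom a))).
- move=> [u|u] [v|v] /= E; move: (gpbP u) (gpbP v); rewrite /= E => -> //= -[?];
  by congr (_ _); apply: gpb_ext.
- move=> x; case E: (bmap a x) => [t|t].
    by exists (inl (@gpb_mk _ _ _ _ (bmap a) (ginl X Y) x t E)).
  by exists (inr (@gpb_mk _ _ _ _ (bmap a) (ginr X Y) x t E)).
- by case=> u /=; exact: gpbP u.
- by apply: af_sum_inj; rewrite /= !af_simp.
Qed.

Definition bcls_res X Y (z : gmap Y X) (u : bcls F X) : bcls F Y :=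
  bcls_of (bres z (bcls_repr u)).
Definition bcls_tr X Y (xi : gmap X Y) (u : bcls F X) : bcls F Y :=
  bcls_of (btr xi (bcls_repr u)).

Lemma bcls_resE X Y (z : gmap Y X) a : bcls_res z (bcls_of a) = bcls_of (bres z a).
Proof. by apply/bcls_eq/bres_iso; exact: bcls_repr_of. Qed.
Lemma bcls_trE X Y (xi : gmap X Y) a : bcls_tr xi (bcls_of a) = bcls_of (btr xi a).
Proof. by apply/bcls_eq/btr_iso; exact: bcls_repr_of. Qed.

Lemma bcls_res_nmod X Y (z : gmap Y X) : nmod_morphism (bcls_res z).
Proof.
split; first by rewrite bcls_resE; exact/bcls_eq/bres_zero.
move=> u v; elim/bcls_ind: u => a; elim/bcls_ind: v => b.
by rewrite bcls_ofD !bcls_resE bcls_ofD; exact/bcls_eq/bres_sum.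
Qed.
Lemma bcls_res_monoid X Y (z : gmap Y X) : monoid_morphism (bcls_res z).
Proof.
split; first by rewrite bcls_resE; exact/bcls_eq/bres_one.
move=> u v; elim/bcls_ind: u => a; elim/bcls_ind: v => b.
by rewrite bcls_ofM !bcls_resE bcls_ofM; exact/bcls_eq/bres_prod.
Qed.
Lemma bcls_tr_nmod X Y (xi : gmap X Y) : nmod_morphism (bcls_tr xi).
Proof.
split; first by rewrite bcls_trE; exact/bcls_eq/btr_zero.
move=> u v; elim/bcls_ind: u => a; elim/bcls_ind: v => b.
by rewrite bcls_ofD !bcls_trE bcls_ofD; exact/bcls_eq/btr_sum.
Qed.

Definition burn X : comPzRingType := groth (bcls F X).
Definition burn_res X Y (z : gmap X Y) : burn Y -> burn X := groth_map (bcls_res z).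
Definition burn_tr X Y (xi : gmap X Y) : burn X -> burn Y := groth_map (bcls_tr xi).

Definition burnside_data : greenData gT := GreenData burn_res burn_tr.

Let resN X Y (z : gmap X Y) := bcls_res_nmod z.
Let trN X Y (z : gmap X Y) := bcls_tr_nmod z.

Lemma burn_res_sub X Y (z : gmap Y X) (a b : bcls F X) :
  burn_res z (groth_in a - groth_in b)
  = groth_in (bcls_res z a) - groth_in (bcls_res z b).
Proof. exact/groth_map_sub/resN. Qed.
Lemma burn_tr_sub X Y (z : gmap X Y) (a b : bcls F X) :
  burn_tr z (groth_in a - groth_in b)
  = groth_in (bcls_tr z a) - groth_in (bcls_tr z b).
Proof. exact/groth_map_sub/trN. Qed.
Lemma burn_tr_in X Y (z : gmap X Y) (a : bcls F X) :
  burn_tr z (groth_in a) = groth_in (bcls_tr z a).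
Proof. exact/groth_map_in/trN. Qed.

Lemma burn_res_nmod X Y (z : gmap Y X) : nmod_morphism (burn_res z).
Proof. exact/groth_map_nmod/resN. Qed.
Lemma burn_tr_zmod X Y (z : gmap X Y) : zmod_morphism (burn_tr z).
Proof. exact/groth_map_zmod/trN. Qed.
Lemma burn_tr_nmod X Y (z : gmap X Y) : nmod_morphism (burn_tr z).
Proof. exact/groth_map_nmod/trN. Qed.
Lemma burn_res_monoid X Y (z : gmap Y X) : monoid_morphism (burn_res z).
Proof. by apply: groth_map_monoid; [exact: resN | exact: bcls_res_monoid]. Qed.

Lemma burn_res_contra : @is_contravariant gT (fun X => burn X) burn_res.
Proof.
split=> [X Y f|X x|X Y Z f h x]; first exact: burn_res_nmod.
  elim/groth_ind: x => a b; rewrite !burn_res_sub.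
  have H (u : bcls F X) : bcls_res (gid X) u = u.
    by elim/bcls_ind: u => c; rewrite bcls_resE; exact/bcls_eq/bres_id.
  by rewrite !H.
elim/groth_ind: x => a b; rewrite [burn_res f _]burn_res_sub !burn_res_sub.
have H (u : bcls F Z) : bcls_res (gcomp f h) u = bcls_res h (bcls_res f u).
  by elim/bcls_ind: u => c; rewrite !bcls_resE; exact/bcls_eq/bres_comp.
by rewrite !H.
Qed.

Lemma burn_tr_cov : @is_covariant gT (fun X => burn X) burn_tr.
Proof.
split=> [X Y f|X x|X Y Z f h x]; first exact: burn_tr_nmod.
  elim/groth_ind: x => a b; rewrite !burn_tr_sub.
  have H (u : bcls F X) : bcls_tr (gid X) u = u.
    by elim/bcls_ind: u => c; rewrite bcls_trE; exact/bcls_eq/btr_id.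
  by rewrite !H.
elim/groth_ind: x => a b; rewrite [burn_tr h _]burn_tr_sub !burn_tr_sub.
have H (u : bcls F X) : bcls_tr (gcomp f h) u = bcls_tr f (bcls_tr h u).
  by elim/bcls_ind: u => c; rewrite !bcls_trE; exact/bcls_eq/btr_comp.
by rewrite !H.
Qed.

Lemma burn_mackey X X' Y Y' (f : gmap Y' Y) (g : gmap X Y)
    (g' : gmap X' Y') (f' : gmap X' X) (x : burn X) :
  is_pullback f g g' f' -> burn_res f (burn_tr g x) = burn_tr g' (burn_res f' x).
Proof.
move=> pb; elim/groth_ind: x => a b.
rewrite [burn_tr g _]burn_tr_sub [burn_res f' _]burn_res_sub burn_res_sub burn_tr_sub.
have H (u : bcls F X) : bcls_res f (bcls_tr g u) = bcls_tr g' (bcls_res f' u).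
  elim/bcls_ind: u => c; rewrite !(bcls_resE, bcls_trE).
  exact/bcls_eq/bmackey.
by rewrite !H.
Qed.

Lemma burn_void (x y : burn (gvoid gT)) : x = y.
Proof.
have H (u : bcls F (gvoid gT)) : u = 0.
  by elim/bcls_ind: u => a; exact/bcls_eq/bvoid.
have H' (u : burn (gvoid gT)) : u = 0.
  by elim/groth_ind: u => a b; rewrite (H a) (H b) subrr.
by rewrite (H' x) (H' y).
Qed.

Section Pullbacks.
Variables X Y : gset gT.

Lemma ginl_pullback :
  is_pullback (ginl X Y) (ginl X Y) (gid X) (gid X).
Proof.
split=> // W a b E; exists a; split=> [|u [<- _]]; last exact: gmap_eq.
split; apply: gmap_eq => // w.
by have [] := congr1 (fun h => gmap_fun h w) E.
Qed.
Lemma ginr_pullback :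
  is_pullback (ginr X Y) (ginr X Y) (gid Y) (gid Y).
Proof.
split=> // W a b E; exists a; split=> [|u [<- _]]; last exact: gmap_eq.
split; apply: gmap_eq => // w.
by have [] := congr1 (fun h => gmap_fun h w) E.
Qed.
Lemma gdisj_pullback :
  is_pullback (ginl X Y) (ginr X Y) (gvoid_map X) (gvoid_map Y).
Proof.
split=> [|W a b E]; first exact: gmap_eq.
have F0 (w : W) : False by have := congr1 (fun h => gmap_fun h w) E.
exists (@GMap gT W (gvoid gT) (fun w => match F0 w with end)
  (fun w g => match F0 w with end)).
by split=> [|u _]; [split|]; apply: gmap_eq => w; case: (F0 w).
Qed.
Lemma gdisj_pullback' :
  is_pullback (ginr X Y) (ginl X Y) (gvoid_map Y) (gvoid_map X).
Proof.
split=> [|W a b E]; first exact: gmap_eq.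
have F0 (w : W) : False by have := congr1 (fun h => gmap_fun h w) E.
exists (@GMap gT W (gvoid gT) (fun w => match F0 w with end)
  (fun w g => match F0 w with end)).
by split=> [|u _]; [split|]; apply: gmap_eq => w; case: (F0 w).
Qed.
End Pullbacks.

Lemma burn_additive : @is_additive gT (fun X => burn X) burn_res.
Proof.
split=> [|X Y]; first exact: burn_void.
have resD A B (f : gmap A B) := (contra_mor burn_res_contra f).2.
have tr0 A B (f : gmap A B) x : x = 0 -> burn_tr f x = 0.
  by move=> ->; exact: (cov_mor burn_tr_cov f).1.
exists (fun p => burn_tr (ginl X Y) p.1 + burn_tr (ginr X Y) p.2).
- elim/groth_ind => a b /=.
  rewrite [burn_res (ginl _ _) _]burn_res_sub [burn_res (ginr _ _) _]burn_res_sub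
     !burn_tr_sub.
  have H (u : bcls F (gsum X Y)) :
      bcls_tr (ginl X Y) (bcls_res (ginl X Y) u)
      + bcls_tr (ginr X Y) (bcls_res (ginr X Y) u) = u.
    elim/bcls_ind: u => c; rewrite !(bcls_resE, bcls_trE) bcls_ofD.
    exact/bcls_eq/bsplit.
  by rewrite addrACA -opprD -!(groth_in_nmod _).2 !H.
- move=> [x y] /=; rewrite !(resD _ _ _ (burn_tr _ x) (burn_tr _ y)).
  rewrite (burn_mackey _ (ginl_pullback X Y)) (burn_mackey _ (ginr_pullback X Y)).
  rewrite (burn_mackey _ (gdisj_pullback X Y)) (burn_mackey _ (gdisj_pullback' X Y)).
  rewrite !(contra_id burn_res_contra) !(cov_id burn_tr_cov).
  rewrite [burn_tr (gvoid_map X) _]tr0 ?[burn_tr (gvoid_map Y) _]tr0 ?addr0 ?add0r //.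
    exact: burn_void.
  exact: burn_void.
Qed.

Lemma burn_frobenius X Y (f : gmap X Y) (x : burn X) (y : burn Y) :
  burn_tr f (x * burn_res f y) = burn_tr f x * y.
Proof.
have [_ inM] := groth_in_monoid (bcls F X).
have [_ inM'] := groth_in_monoid (bcls F Y).
have H (u : bcls F X) (v : bcls F Y) :
    bcls_tr f (u * bcls_res f v) = bcls_tr f u * v.
  elim/bcls_ind: u => a; elim/bcls_ind: v => b.
  rewrite !(bcls_resE, bcls_trE, bcls_ofM); exact/bcls_eq/bfrobenius.
elim/groth_ind: x => a b; elim/groth_ind: y => c d.
rewrite burn_res_sub burn_tr_sub !mulrBl !mulrBr -!inM -!inM'.
by rewrite !burn_tr_zmod !burn_tr_in !H.
Qed.

Lemma burnside_is_green : is_green burnside_data.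
Proof.
split=> [|X Y f|X Y f x y].
- split; [exact: burn_res_contra | exact: burn_tr_cov | | exact: burn_additive].
  by move=> X X' Y Y' f g g' f' pb x; exact: burn_mackey.
- exact: burn_res_monoid.
- exact: burn_frobenius.
Qed.

Definition burnside : green gT := Green burnside_is_green.
End BurnsideGreen.

(* Main.v *)
Require Import Defs.
From mathcomp Require Import all_boot all_fingroup.
From mathcomp Require Import all_algebra.
From mathcomp Require Import boolp.

(* On objects, the norm along eta : X -> Y sends (p : A -> X, m) to Pi_eta(A)
   labelled by M_*(rho) M^*(lambda)(m).  Every Tambara identity between such
   objects reduces to recognising Pi_eta(A) by its universal property: it is the
   set of sections of A over the fibres of eta.  The norm is not additive, but it
   is polynomial: its k-th difference in the directions b_1, ..., b_k counts the
   sections that meet every b_i, so it vanishes once k exceeds the size of the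
   fibres.  A polynomial map on a commutative monoid extends uniquely to a
   polynomial map on the group completion, and polynomial maps compose; hence the
   norm extends to the Grothendieck rings, and the identities follow from their
   validity on objects. *)

Set Implicit Arguments.
Unset Strict Implicit.
Unset Printing Implicit Defensive.

Import GRing.Theory.
Local Open Scope ring_scope.
Local Open Scope gset_scope.

(** * Polynomial maps from commutative monoids to abelian groups *)

Section PolynomialMaps.
Implicit Types (S : nmodType) (B : zmodType).

Lemma subrACA B (a b c d : B) : a - b - (c - d) = a - c - (b - d).
Proof. by rewrite !opprB [d - c]addrC addrACA [- b + d]addrC. Qed.

(** The bound is strict so that the recursion starts at the zero map: constants have degree below 1,
    homomorphisms below 2. *)
Fixpoint deg_lt S B n (f : S -> B) : Prop :=
  if n is m.+1 then forall s, deg_lt m (fun x => f (x + s) - f x)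
  else forall x, f x = 0.

Lemma eq_deg_lt S B n (f g : S -> B) : f =1 g -> deg_lt n f -> deg_lt n g.
Proof. by move=> /funext ->. Qed.

Lemma deg_lt_post S B B' n (h : B -> B') (f : S -> B) :
  zmod_morphism h -> deg_lt n f -> deg_lt n (h \o f).
Proof.
move=> hB; elim: n f => [|n IH] f fn /=.
  by move=> x; rewrite fn -(subrr 0) hB subrr.
by move=> s; apply: eq_deg_lt (IH _ (fn s)) => x /=; rewrite hB.
Qed.

Lemma deg_ltB S B n (f g : S -> B) :
  deg_lt n f -> deg_lt n g -> deg_lt n (fun x => f x - g x).
Proof.
elim: n f g => [|n IH] f g fn gn /=; first by move=> x; rewrite fn gn subrr.
move=> s; apply: eq_deg_lt (IH _ _ (fn s) (gn s)) => x /=.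
exact: subrACA.
Qed.

Lemma deg_ltN S B n (f : S -> B) : deg_lt n f -> deg_lt n (fun x => - f x).
Proof. by apply: (@deg_lt_post _ _ _ _ -%R) => x y; rewrite opprD. Qed.

Lemma deg_ltD S B n (f g : S -> B) :
  deg_lt n f -> deg_lt n g -> deg_lt n (fun x => f x + g x).
Proof.
move=> fn gn; apply: eq_deg_lt (deg_ltB fn (deg_ltN gn)) => x /=.
by rewrite opprK.
Qed.

Lemma deg_ltS S B n (f : S -> B) : deg_lt n f -> deg_lt n.+1 f.
Proof.
elim: n f => [|n IH] f fn; first by move=> s x; rewrite !fn subrr.
by move=> s; exact: IH (fn s).
Qed.

Lemma deg_lt_leq S B m n (f : S -> B) : (m <= n)%N -> deg_lt m f -> deg_lt n f.
Proof.
by move=> /subnKC <-; elim: (n - m)%N => [|k IH]; rewrite ?addn0 // addnS => /IH/deg_ltS.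
Qed.

Lemma deg_lt_shift S B n (t : S) (f : S -> B) :
  deg_lt n f -> deg_lt n (fun x => f (x + t)).
Proof.
elim: n f => [|n IH] f fn /=; first by move=> x; exact: fn.
by move=> s; apply: eq_deg_lt (IH _ (fn s)) => x; rewrite addrAC.
Qed.

(* Composition is the case where K is constant in x; for varying K the
   difference of x |-> K x (f x) is a sum of maps of the same shape in which K
   has smaller degree in x or in u, its dependence on x being controlled by that
   of the difference of f. *)
Lemma deg_lt_diag S (T B : zmodType) d j n : exists N,
  forall (f : S -> T) (K : S -> T -> B), deg_lt d f ->
    (forall x, deg_lt j (K x)) -> (forall u, deg_lt n (K^~ u)) ->
    deg_lt N (fun x => K x (f x)).
Proof.
elim: d j n => [|d IHd] j n.
  by exists n => f K f0 _ Kn; apply: eq_deg_lt (Kn 0) => x; rewrite f0.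
elim: j n => [|j IHj] n; first by exists 0%N => f K _ K0 _ x; exact: K0.
elim: n => [|n [N1 IHn]]; first by exists 0%N => f K _ _ K0 x; exact: K0.
(* [N0] will bound the degree in x of [K x (u + g x)], where g is a difference of f, for all u and
   all directions at once; this is why the bound has to be uniform in f and K. *)
have [N0 IH0] := IHd j.+1 n.+1.
have [N2 IH2] := IHj (maxn N0 n.+1).
exists (maxn N1 N2).+1 => f K fd Kj Kn s.
have H1 : deg_lt N1 (fun x => K (x + s) (f (x + s)) - K x (f (x + s))).
  apply: (IHn (fun x => f (x + s)) (fun x u => K (x + s) u - K x u)).
  - exact: deg_lt_shift.
  - by move=> x; apply: deg_ltB.
  - by move=> u; exact: Kn.
have H2 : deg_lt N2 (fun x => K x (f x + (f (x + s) - f x)) - K x (f x)).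
  apply: (IH2 f (fun x u => K x (u + (f (x + s) - f x)) - K x u)) => //.
    by move=> x; exact: Kj.
  move=> u; apply: deg_ltB; last by apply: deg_lt_leq (Kn u); exact: leq_maxr.
  apply: deg_lt_leq (leq_maxl _ _) _.
  apply: (IH0 (fun x => f (x + s) - f x) (fun x v => K x (u + v))) => //.
  move=> x; apply: eq_deg_lt (deg_lt_shift u (Kj x)) => v.
  by rewrite addrC.
have := deg_ltD (deg_lt_leq (leq_maxl N1 N2) H1) (deg_lt_leq (leq_maxr N1 N2) H2).
by apply: eq_deg_lt => x; rewrite [f x + _]addrC subrK addrA subrK.
Qed.

Definition polynomial S B (f : S -> B) : Prop := exists n, deg_lt n f.

Lemma polynomial_comp S (T B : zmodType) (g : T -> B) (f : S -> T) :
  polynomial g -> polynomial f -> polynomial (g \o f).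
Proof.
(* A kernel that is constant in x has degree below 1 in x. *)
move=> [j gj] [d fd]; have [N HN] := deg_lt_diag S T B d j 1%N.
exists N; apply: (HN f (fun _ => g)) => // u s x; exact: subrr.
Qed.

Lemma polynomial_morph (T B : zmodType) (h : T -> B) :
  zmod_morphism h -> polynomial h.
Proof.
move=> hB; exists 2%N => s t x /=.
by rewrite -!hB [x + t + s]addrC [x + s]addrC !addrK subrr -(subrr 0) hB subrr.
Qed.
End PolynomialMaps.

(** * Extension of polynomial maps to the Grothendieck group *)

Section PolynomialExtension.
Variables (S : comPzSemiRingType) (B : zmodType).
Implicit Types (a b c : S) (x y : groth S).
Local Notation "[ a ]" := (groth_in a).

Let inD a b : [a + b] = [a] + [b] := (groth_in_nmod S).2 a b.

(** The difference of f in direction [[b]] has lower degree and also vanishes on S. By induction it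
    is 0 at [[a] - [b]], where it compares [f [a] = 0] with [f ([a] - [b])]. *)
Lemma deg_lt_groth_eq0 n (f : groth S -> B) :
  deg_lt n f -> (forall a, f [a] = 0) -> forall x, f x = 0.
Proof.
elim: n f => [|n IH] f fn f0 x; first exact: fn.
elim/groth_ind: x => a b.
have H c : f ([c] + [b]) - f [c] = 0 by rewrite -inD !f0 subrr.
have := IH _ (fn [b]) H ([a] - [b]).
by rewrite subrK f0 sub0r => /eqP; rewrite oppr_eq0 => /eqP.
Qed.

(** Uniqueness of polynomial extensions. It reduces identities between norms on Grothendieck rings
    to classes of labelled sets. *)
Lemma polynomial_groth_eq (f g : groth S -> B) :
  polynomial f -> polynomial g -> (forall a, f [a] = g [a]) -> f =1 g.
Proof.
move=> [m fm] [n gn] E x; apply/eqP; rewrite -subr_eq0; apply/eqP.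
apply: (@deg_lt_groth_eq0 (maxn m n) (fun x => f x - g x)) => [|a].
  by apply: deg_ltB; [apply: deg_lt_leq fm | apply: deg_lt_leq gn];
    rewrite (leq_maxl, leq_maxr).
by rewrite E subrr.
Qed.

(* Induction on the degree: if D b extends x |-> f (x + b) - f x, then the
   extension of f must send a - b to f a - D b (a - b). *)
Lemma deg_lt_groth_ext n (f : S -> B) : deg_lt n f ->
  exists g : groth S -> B, deg_lt n g /\ forall a, g [a] = f a.
Proof.
elim: n f => [|n IH] f fn; first by exists (fun=> 0); split=> // a; rewrite fn.
pose D b := sval (cid (IH _ (fn b))).
have Dn b : deg_lt n (D b) by rewrite /D; case: cid => ? [].
have DE b a : D b [a] = f (a + b) - f a by rewrite /D; case: cid => ? [].
(* The cocycle rule for differences telescopes on S and passes to [groth S] by uniqueness. *)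
have D_add b c x : D (b + c) x = D c (x + [b]) + D b x.
  apply: (@polynomial_groth_eq (D (b + c)) (fun x => D c (x + [b]) + D b x)).
  - by exists n.
  - by exists n; apply: deg_ltD => //; exact: deg_lt_shift.
  - by move=> a; rewrite -inD !DE addrA [RHS]addrA subrK.
pose F (u : S * S) := f u.1 - D u.2 ([u.1] - [u.2]).
(* Invariance under adding c to both entries makes the prescribed value depend only on the class of
   the pair. *)
have F_add a b c : F (a + c, b + c) = F (a, b).
  rewrite /F /=; have -> : [a + c] - [b + c] = [a] - [b].
    by rewrite !inD opprD addrACA subrr addr0.
  rewrite D_add subrK DE.
  by rewrite opprD opprB !addrA [f (a + c) + _]addrC addrK.
pose g x := F (groth_repr x).
have gE a b : g ([a] - [b]) = F (a, b).
  rewrite /g; have [k] := groth_repr_of (a, b).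
  rewrite (groth_ofE (a, b)) /=; case: (groth_repr _) => a' b' /= E.
  rewrite -(F_add a' b' (b + k)) -(F_add a b (b' + k)) !addrA E.
  by rewrite [b' + b]addrC.
have g_in c x : g (x + [c]) - g x = D c x.
  elim/groth_ind: x => a b.
  have E : [a] - [b] + [c] = [a + c] - [b] by rewrite inD addrAC.
  rewrite E !gE /F /= -E.
  set x := [a] - [b].
  (* Adding b and c in either order gives two cocycle expansions of the same difference. *)
  have H := etrans (esym (D_add b c x)) (etrans (congr1 (D^~ x) (addrC b c)) (D_add c b x)).
  have Ea : D c (x + [b]) = f (a + c) - f a by rewrite subrK DE.
  by rewrite subrACA opprB addrA -Ea H addrAC subrr add0r.
exists g; split=> [s|a].
  (* [g_in] covers only directions from S. In direction [[c] - [e]] the difference of g at x is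
     [D c - D e] evaluated at [x - [e]]. *)
  elim/groth_ind: s => c e.
  have H := deg_ltB (Dn c) (Dn e).
  apply: eq_deg_lt (deg_lt_shift (- [e]) H) => x /=.
  by rewrite -!g_in subrK opprB addrA subrK addrA [x - _ + _]addrAC.
have E0 : [a] - [0] = [a] by rewrite (groth_in_nmod S).1 subr0.
by rewrite -[in LHS]E0 gE /F /= E0 DE addr0 subrr subr0.
Qed.
End PolynomialExtension.

(** * Pullbacks and sections over fibres *)

Section Pullback.
Variables (gT : finGroupType) (X X' Y Y' : gset gT).
Variables (f : gmap Y' Y) (g : gmap X Y) (g' : gmap X' Y') (f' : gmap X' X).

(** Joint injectivity makes the chosen preimages equivariant and the induced map unique. *)
Lemma is_pullbackI :
  (forall w, g (f' w) = f (g' w)) ->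
  (forall v w, f' v = f' w -> g' v = g' w -> v = w) ->
  (forall x y, g x = f y -> exists w, f' w = x /\ g' w = y) ->
  is_pullback f g g' f'.
Proof.
move=> comm inj surj; split=> [|W a b E]; first exact: gmap_eq.
have ab w : g (a w) = f (b w) := congr1 (fun h => gmap_fun h w) E.
pose u w := sval (cid (surj _ _ (ab w))).
have uP w : f' (u w) = a w /\ g' (u w) = b w by rewrite /u; case: cid.
have uE w h : u (w ⋅ h) = u w ⋅ h.
  by apply: inj; rewrite (proj1 (uP _), proj2 (uP _)) !gmap_equiv (proj1 (uP _), proj2 (uP _)).
exists (GMap uE); split; first by split; apply: gmap_eq => w /=; case: (uP w).
move=> v [va vb]; apply: gmap_eq => w /=; have [u1 u2] := uP w.
by apply: inj; rewrite ?u1 ?u2 -?va -?vb.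
Qed.

Lemma is_pullback_comm : is_pullback f g g' f' -> forall w, g (f' w) = f (g' w).
Proof. by case/is_pullback_ex. Qed.

Lemma is_pullback_inj : is_pullback f g g' f' ->
  forall v w, f' v = f' w -> g' v = g' w -> v = w.
Proof.
case/is_pullback_ex=> comm [u [_ _ uK]] v w E1 E2.
by rewrite -(uK v (comm v)) -(uK w (comm w)); congr (u _); exact: gpb_ext.
Qed.

Lemma is_pullback_surj : is_pullback f g g' f' ->
  forall x y, g x = f y -> exists w, f' w = x /\ g' w = y.
Proof.
by case/is_pullback_ex=> _ [u [u1 u2 _]] x y E; exists (u (gpb_mk E)); rewrite u1 u2.
Qed.

End Pullback.

Lemma gpb_pullback (gT : finGroupType) (X Y Z : gset gT) (f : gmap X Z)
  (h : gmap Y Z) : is_pullback h f (gpb2 f h) (gpb1 f h).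
Proof.
apply: is_pullbackI; first exact: gpbP.
- exact: gpb_ext.
- by move=> x y E; exists (gpb_mk E).
Qed.

(** * Evaluating the points of a dependent product *)

Section Sections.
Variables (gT : finGroupType) (A X Y : gset gT) (eta : gmap X Y) (p : gmap A X).
Implicit Types (u v : gpi eta p) (x : X).

(** The fibre condition is a propositional equality here, so that points and arguments can be
    rewritten without carrying boolean proofs. *)
Definition gapp u x (h : eta x = gpi_pt u) : A :=
  gpi_sec u (exist _ x (introT eqP h)).

Lemma gappP u x (h : eta x = gpi_pt u) : p (gapp h) = x.
Proof. exact: gpi_secP. Qed.

Lemma gpi_sec_gapp u x (h : eta x == gpi_pt u) :
  gpi_sec u (exist _ x h) = gapp (eqP h).
Proof. by congr gpi_sec; exact: val_inj. Qed.

Lemma gapp_eq u v x x' (h : eta x = gpi_pt u) (h' : eta x' = gpi_pt v) :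
  u = v -> x = x' -> gapp h = gapp h'.
Proof.
by move=> E E'; move: h'; rewrite -E -E' => h'; congr gpi_sec; exact: val_inj.
Qed.

Lemma gpi_gapp_ext u v : gpi_pt u = gpi_pt v ->
  (forall x (h : eta x = gpi_pt u) (k : eta x = gpi_pt v), gapp h = gapp k) ->
  u = v.
Proof. by move=> E H; apply: gpi_ext => // x h k; rewrite !gpi_sec_gapp. Qed.

Section Mk.
Variables (y : Y) (s : forall x, eta x = y -> A).
Hypothesis sP : forall x (h : eta x = y), p (s h) = x.

Definition gpi_mk : gpi eta p :=
  @GPi gT A X Y eta p y (fun z => s (eqP (valP z))) (fun z => sP (eqP (valP z))).

Lemma gapp_mk x (h : eta x = gpi_pt gpi_mk) : gapp h = s h.
Proof. by rewrite /gapp /=; congr s; exact: Prop_irrelevance. Qed.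
End Mk.

Lemma gapp_act u x g (h : eta x = gpi_pt u) (h' : eta (x ⋅ g) = gpi_pt (u ⋅ g)) :
  gapp h' = gapp h ⋅ g.
Proof.
by rewrite /gapp /=; congr (_ ⋅ _); congr gpi_sec; apply: val_inj; rewrite /= gopK.
Qed.

Lemma gpi_lambdaE (w : gpb eta (gpi_proj eta p)) u x (h : eta x = gpi_pt u) :
  gpb1 _ _ w = x -> gpb2 _ _ w = u -> gpi_lambda eta p w = gapp h.
Proof.
move=> E1 E2; transitivity (gapp (gpbP w)); last exact: gapp_eq.
by congr gpi_sec; exact: val_inj.
Qed.

Lemma gpi_lambdaP (w : gpb eta (gpi_proj eta p)) :
  p (gpi_lambda eta p w) = gpb1 _ _ w.
Proof. by rewrite (gpi_lambdaE (gpbP w)) ?gappP. Qed.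

End Sections.

(** * The norm of labelled sets *)

Section Norm.
Variables (gT : finGroupType) (M : semiMackey gT).
Local Notation F := (sm_contra M).
Implicit Types X Y Z A : gset gT.

Definition lab_tr X Y (f : gmap X Y) (m : F X) : F Y := @sm_tr gT M X Y f m.

Lemma lab_tr0 X Y (f : gmap X Y) : lab_tr f 0 = 0.
Proof. exact: (cov_mor (smk_cov (sm_axioms M)) f).1. Qed.
Lemma lab_trD X Y (f : gmap X Y) (m n : F X) :
  lab_tr f (m + n) = lab_tr f m + lab_tr f n.
Proof. exact: (cov_mor (smk_cov (sm_axioms M)) f).2. Qed.
Lemma lab_tr_id X (m : F X) : lab_tr (gid X) m = m.
Proof. exact: (cov_id (smk_cov (sm_axioms M))). Qed.
Lemma lab_tr_comp X Y Z (f : gmap Y Z) (g : gmap X Y) (m : F X) :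
  lab_tr f (lab_tr g m) = lab_tr (gcomp f g) m.
Proof. exact/esym/(cov_comp (smk_cov (sm_axioms M))). Qed.
Lemma lab_mackey X X' Y Y' (f : gmap Y' Y) (g : gmap X Y) (g' : gmap X' Y')
    (f' : gmap X' X) (m : F X) : is_pullback f g g' f' ->
  af_res f (lab_tr g m) = lab_tr g' (af_res f' m).
Proof. by move=> pb; apply: (smk_pullback (sm_axioms M) pb). Qed.

Definition bnrm X Y (eta : gmap X Y) (a : bobj F X) : bobj F Y :=
  BObj (gpi_proj eta (bmap a))
    (lab_tr (gpi_rho eta (bmap a)) (af_res (gpi_lambda eta (bmap a)) (blab a))).

Section Evaluation.
Variables (X Y : gset gT) (eta : gmap X Y) (a : bobj F X) (c : bobj F Y).
Variables (E : gset gT) (e1 : gmap E X) (e2 : gmap E (bdom c)) (ev : gmap E (bdom a)).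

(* E plays the role of the fibre product of X and C over Y, and ev that of the
   evaluation map (x, sigma) |-> sigma(x) on a set C of partial sections. *)
Record is_eval : Prop := {
  ev_pb : is_pullback (bmap c) eta e2 e1;
  ev_over : forall e, bmap a (ev e) = e1 e;
  ev_lab : lab_tr e2 (af_res ev (blab a)) = blab c }.

Hypothesis evP : is_eval.

(** Universal property of the dependent product: restricted to the points of E over z, [ev] is a
    section over a fibre of [eta], and z is sent to it. Labels agree by the Mackey formula for the
    base change of [gpi_rho] along this map. *)
Lemma bnrm_map : exists phi : bhom c (bnrm eta a),
  forall e (h : eta (e1 e) = gpi_pt (phi (e2 e))), gapp h = ev e.
Proof.
have comm := is_pullback_comm (ev_pb evP).
have inj := is_pullback_inj (ev_pb evP).
have surj := is_pullback_surj (ev_pb evP).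
(* The point of E over (x, z) is unique, so the choice does not affect the value; this is [sE]. *)
pose s z x (h : eta x = bmap c z) := ev (sval (cid (surj _ _ h))).
have sE e z x (h : eta x = bmap c z) : e1 e = x -> e2 e = z -> s z x h = ev e.
  by rewrite /s; case: cid => e' /= [<- <-] E1 E2; congr (ev _); exact: inj.
have sP z x (h : eta x = bmap c z) : bmap a (s z x h) = x.
  by have [e [E1 E2]] := surj _ _ h; rewrite (sE e) // (ev_over evP).
pose phi z : gpi eta (bmap a) := gpi_mk (sP z).
have phiE z g : phi (z ⋅ g) = phi z ⋅ g.
  apply: gpi_gapp_ext => [|x]; first by rewrite /= gmap_equiv.
  rewrite -[x](gopKV _ g); move: (x ⋅ g^-1%g) => {}x h k.
  have h1 : eta x ⋅ g = bmap c z ⋅ g by rewrite -!gmap_equiv.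
  have h0 : eta x = bmap c z by rewrite -(gopK (eta x) g) h1 gopK.
  have [e [E1 E2]] := surj _ _ h0.
  rewrite (gapp_act (u := phi z) h0) !gapp_mk (sE e z x) //.
  by rewrite (sE (e ⋅ g)) gmap_equiv ?E1 ?E2.
have over : gcomp (gpi_proj eta (bmap a)) (GMap phiE) = bmap c by exact: gmap_eq.
have phi_ev e (h : eta (e1 e) = gpi_pt (phi (e2 e))) : gapp h = ev e.
  by rewrite gapp_mk (sE e).
have comm' e : eta (e1 e) = gpi_proj eta (bmap a) (gcomp (GMap phiE) e2 e).
  exact: comm.
have pb : is_pullback (GMap phiE : gmap (bdom c) (gpi eta (bmap a)))
    (gpi_rho eta (bmap a)) e2 (gpb_lift comm').
  apply: is_pullbackI => [//|v w [] E1 _ E2|w z E']; first exact: inj.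
  have h : eta (gpb1 _ _ w) = bmap c z.
    by rewrite (gpbP w) -[bmap c z]/(gpi_pt (phi z)) -[phi z]E'.
  have [e [E1 E2]] := surj _ _ h; exists e; split=> //; apply: gpb_ext => //=.
  by rewrite E2; exact/esym.
have lab : af_res (GMap phiE) (blab (bnrm eta a)) = blab c.
  apply: etrans (lab_mackey _ pb) _.
  rewrite (af_res_res (h := ev)) ?(ev_lab evP) // => e.
  by rewrite -(phi_ev e (comm e)); exact: gpi_lambdaE.
by exists (@BHom _ _ _ c (bnrm eta a) (GMap phiE) over lab).
Qed.

(** The two conditions say that points of [c] over the same base point are separated by their
    sections and that every section occurs. The structural identities for the norm are checked in
    this form. *)
Lemma bnrm_iso_eval :
  (forall z z', bmap c z = bmap c z' ->
     (forall e e', e2 e = z -> e2 e' = z' -> e1 e = e1 e' -> ev e = ev e') ->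
     z = z') ->
  (forall u : gpi eta (bmap a), exists2 z, bmap c z = gpi_pt u &
     forall e (h : eta (e1 e) = gpi_pt u), e2 e = z -> ev e = gapp h) ->
  biso c (bnrm eta a).
Proof.
move=> inj surj; have [phi phiE] := bnrm_map.
have comm := is_pullback_comm (ev_pb evP).
have ptE z : gpi_pt (phi z) = bmap c z by exact: (bhom_overE phi).
apply: (@biso_bij _ _ _ c (bnrm eta a) phi).
- move=> z z' Ez; apply: inj => [|e e' E1 E2 E3]; first by rewrite -!ptE Ez.
  have h : eta (e1 e) = gpi_pt (phi (e2 e)) by rewrite ptE.
  have h' : eta (e1 e') = gpi_pt (phi (e2 e')) by rewrite ptE.
  by rewrite -(phiE _ h) -(phiE _ h'); apply: gapp_eq; rewrite ?E1 ?E2.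
- move=> u; have [z Ez evz] := surj u; exists z.
  apply: gpi_gapp_ext => [|x h k]; first by rewrite ptE.
  have [e [E1 E2]] : exists e, e1 e = x /\ e2 e = z.
    by apply: (is_pullback_surj (ev_pb evP)); rewrite Ez.
  have h' : eta (e1 e) = gpi_pt (phi (e2 e)) by rewrite ptE.
  have k' : eta (e1 e) = gpi_pt u by rewrite E1.
  rewrite (@gapp_eq _ _ _ _ _ _ _ (phi (e2 e)) _ (e1 e) h h') ?E1 ?E2 // phiE.
  by rewrite (evz _ k') //; apply: gapp_eq.
- by move=> z; exact: ptE.
- exact: bhom_lab.
Qed.

End Evaluation.

End Norm.
Arguments is_eval {gT M X Y} eta a c {E} e1 e2 ev.

(** * Compatibility of the norm with products, composition, base change and transfer *)

Section NormIso.
Variables (gT : finGroupType) (M : semiMackey gT).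
Local Notation F := (sm_contra M).
Implicit Types X Y Z A : gset gT.

(** Sections of [a] become sections of [b] by composition with f, which makes the norm
    functorial. *)
Lemma bnrm_bhom_eval X Y (eta : gmap X Y) (a b : bobj F X) (f : bhom a b) :
  is_eval eta b (bnrm eta a) (gpb1 _ _) (gpi_rho eta (bmap a))
    (gcomp f (gpi_lambda eta (bmap a))).
Proof.
split; first exact: gpb_pullback.
- by move=> e; rewrite [LHS]bhom_overE gpi_lambdaP.
- by rewrite af_comp bhom_lab.
Qed.

Lemma bnrm_iso X Y (eta : gmap X Y) (a b : bobj F X) :
  biso a b -> biso (bnrm eta a) (bnrm eta b).
Proof.
case=> f [f' [fK f'K]]; apply: bnrm_iso_eval (bnrm_bhom_eval eta f) _ _.
- move=> z z' Ez H; apply: gpi_gapp_ext => // x h k; apply: (can_inj fK).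
  have := H (gpb_mk (h : eta x = gpi_proj eta (bmap a) z))
    (gpb_mk (k : eta x = gpi_proj eta (bmap a) z')) erefl erefl erefl.
  rewrite -[LHS]/(f (gpi_lambda _ _ _)) -[RHS]/(f (gpi_lambda _ _ _)).
  by rewrite (gpi_lambdaE h) // (gpi_lambdaE k).
- move=> u; have sP x (h : eta x = gpi_pt u) : bmap a (f' (gapp h)) = x.
    by rewrite bhom_overE gappP.
  exists (gpi_mk sP) => // e h E; rewrite -[LHS]/(f (gpi_lambda _ _ _)).
  by rewrite (gpi_lambdaE (u := gpi_mk sP) h) // gapp_mk f'K.
Qed.

(** The identity of X has exactly one section over each fibre of [eta], so X itself serves as
    evaluation set. *)
Lemma bnrm_one X Y (eta : gmap X Y) : biso (bnrm eta (bone F X)) (bone F Y).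
Proof.
apply: biso_sym.
apply: (@bnrm_iso_eval _ _ _ _ eta (bone F X) (bone F Y) X (gid X) eta (gid X)).
- split=> //; last first.
    exact: etrans (congr1 (@lab_tr _ M _ _ eta) (@af_res0 _ F _ _ (gid X)))
      (@lab_tr0 _ M _ _ eta).
  by apply: is_pullbackI => // x y E; exists x.
- by [].
- by move=> u; exists (gpi_pt u) => // e h _; exact/esym/(gappP h).
Qed.

Lemma bnrm_id X (a : bobj F X) : biso (bnrm (gid X) a) a.
Proof.
apply: biso_sym.
apply: (@bnrm_iso_eval _ _ _ _ (gid X) a a (bdom a) (bmap a) (gid _) (gid _)).
- split=> //; last by rewrite lab_tr_id af_res_id.
  by apply: is_pullbackI => // x y E; exists y.
- by move=> z z' E H; exact: (H z z').
- move=> u; have h0 : gid X (gpi_pt u) = gpi_pt u by [].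
  exists (gapp h0) => [|e h E]; first by rewrite gappP.
  rewrite [LHS]E; exact: gapp_eq.
Qed.

(** A section of a fibre product is a pair of sections. *)
Lemma bnrm_prod X Y (eta : gmap X Y) (a b : bobj F X) :
  biso (bnrm eta (bprod a b)) (bprod (bnrm eta a) (bnrm eta b)).
Proof.
apply: biso_sym; set c := bprod (bnrm eta a) (bnrm eta b).
pose E := gpb eta (bmap c).
have eA (w : E) : eta (gpb1 _ _ w)
    = gpi_proj eta (bmap a) (gcomp (gpb1 _ _) (gpb2 _ _) w).
  exact: gpbP w.
have eB (w : E) : eta (gpb1 _ _ w)
    = gpi_proj eta (bmap b) (gcomp (gpb2 _ _) (gpb2 _ _) w).
  by rewrite (gpbP w); exact: (gpbP (gpb2 _ _ w)).
have eAB (w : E) : bmap a (gcomp (gpi_lambda eta (bmap a)) (gpb_lift eA) w)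
    = bmap b (gcomp (gpi_lambda eta (bmap b)) (gpb_lift eB) w).
  by rewrite [LHS]gpi_lambdaP [RHS]gpi_lambdaP.
apply: (@bnrm_iso_eval _ _ _ _ eta (bprod a b) c E (gpb1 _ _) (gpb2 _ _) (gpb_lift eAB)).
- split; first exact: gpb_pullback.
  + by move=> w; exact: (gpi_lambdaP (gpb_lift eA w)).
  (* E is also the base change of each factor's [gpi_rho] along the projection from [c], so the
     Mackey formula transports the two labels separately. *)
  + have pbA : is_pullback (gpb1 _ _ : gmap (bdom c) (bdom (bnrm eta a)))
        (gpi_rho eta (bmap a)) (gpb2 _ _ : gmap E _) (gpb_lift eA).
      apply: is_pullbackI => //.
        by move=> v w [] E1 _ E2; exact: gpb_ext.
      move=> w z E1; have h : eta (gpb1 _ _ w) = bmap c z.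
        by rewrite (gpbP w); exact: (congr1 _ E1).
      by exists (gpb_mk h); split=> //; apply: gpb_ext => //; exact/esym.
    have pbB : is_pullback (gpb2 _ _ : gmap (bdom c) (bdom (bnrm eta b)))
        (gpi_rho eta (bmap b)) (gpb2 _ _ : gmap E _) (gpb_lift eB).
      apply: is_pullbackI => //.
        by move=> v w [] E1 _ E2; exact: gpb_ext.
      move=> w z E1; have h : eta (gpb1 _ _ w) = bmap c z.
        exact: etrans (gpbP w) (etrans (congr1 (gpi_proj eta (bmap b)) E1) (esym (gpbP z))).
      by exists (gpb_mk h); split=> //; apply: gpb_ext => //; exact/esym.
    rewrite af_resD lab_trD af_lift1 af_lift2.
    rewrite (af_comp _ (gpb_lift eA)) (af_comp _ (gpb_lift eB)).
    by rewrite -(lab_mackey _ pbA) -(lab_mackey _ pbB).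
- move=> z z' Ez H.
  have H' x (h : eta x = bmap c z) (h' : eta x = bmap c z') :=
    H (gpb_mk h) (gpb_mk h') erefl erefl erefl.
  apply: gpb_ext; apply: gpi_gapp_ext.
  + by [].
  + move=> x h k; have := congr1 (gpb1 _ _) (H' x h k).
    rewrite -[LHS]/(gpi_lambda _ _ _) -[RHS]/(gpi_lambda _ _ _).
    by rewrite (gpi_lambdaE h) // (gpi_lambdaE k).
  + by rewrite -[LHS](gpbP z) -[RHS](gpbP z').
  + move=> x h k; have h' : eta x = bmap c z by rewrite h; exact/esym/(gpbP z).
    have k' : eta x = bmap c z' by rewrite k; exact/esym/(gpbP z').
    have := congr1 (gpb2 _ _) (H' x h' k').
    rewrite -[LHS]/(gpi_lambda _ _ _) -[RHS]/(gpi_lambda _ _ _).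
    by rewrite (gpi_lambdaE h) // (gpi_lambdaE k).
- move=> u.
  have sA x (h : eta x = gpi_pt u) : bmap a (gpb1 _ _ (gapp h)) = x by exact: (gappP h).
  have sB x (h : eta x = gpi_pt u) : bmap b (gpb2 _ _ (gapp h)) = x.
    by rewrite -gpbP.
  have e : gpi_proj eta (bmap a) (gpi_mk sA) = gpi_proj eta (bmap b) (gpi_mk sB) by [].
  exists (gpb_mk e) => // w h E1; apply: gpb_ext.
    rewrite -[LHS]/(gpi_lambda _ _ _).
    apply: etrans (gpi_lambdaE (u := gpi_mk sA) h _ _) (gapp_mk _) => //.
  exact: (congr1 (gpb1 _ _) E1).
  rewrite -[LHS]/(gpi_lambda _ _ _).
  apply: etrans (gpi_lambdaE (u := gpi_mk sB) h _ _) (gapp_mk _) => //.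
  exact: (congr1 (gpb2 _ _) E1).
Qed.

(** A section over a fibre of [gcomp f h] is a family of sections over fibres of h, indexed by a
    fibre of f. *)
Lemma bnrm_comp X Y Z (f : gmap Y Z) (h : gmap X Y) (a : bobj F X) :
  biso (bnrm (gcomp f h) a) (bnrm f (bnrm h a)).
Proof.
apply: biso_sym; set c := bnrm f (bnrm h a).
pose l1 := gpi_lambda f (gpi_proj h (bmap a)); pose r2 := gpi_rho h (bmap a).
(* Presenting the evaluation set as a fibre product over the inner dependent product lets the Mackey
   formula merge the two nested label transfers. *)
pose E := gpb r2 l1.
pose e1 : gmap E X := gcomp (gpb1 _ _) (gpb1 _ _).
pose e2 : gmap E (bdom c) := gcomp (gpi_rho f _) (gpb2 _ _).
pose ev : gmap E (bdom a) := gcomp (gpi_lambda h (bmap a)) (gpb1 _ _).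
have e1_pt (e : E) : h (e1 e) = gpb1 _ _ (gpb2 _ _ e).
  by rewrite -gpi_lambdaP -[gpi_lambda _ _ _](gpbP e); exact: (gpbP (gpb1 _ _ e)).
have evE (e : E) (u : gpi f (gpi_proj h (bmap a))) y (h1 : f y = gpi_pt u) x
    (h2 : h x = gpi_pt (gapp h1 : gpi h (bmap a))) :
    e1 e = x -> e2 e = u -> ev e = gapp h2.
  move=> E1 E2; apply: gpi_lambdaE => //; rewrite -[LHS]/(r2 _) gpbP.
  apply: gpi_lambdaE => //; rewrite -e1_pt E1 h2; exact: (gappP h1).
have pb : is_pullback (bmap c) (gcomp f h) e2 e1.
  apply: is_pullbackI.
  - by move=> e; rewrite -[LHS]/(f (h (e1 e))) e1_pt; exact: gpbP.
  - move=> v w E1 E2.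
    have E3 : gpb2 _ _ v = gpb2 _ _ w by apply: gpb_ext => //; rewrite -!e1_pt E1.
    apply: gpb_ext => //; apply: gpb_ext => //.
    by rewrite -[LHS]/(r2 _) -[RHS]/(r2 _) !gpbP E3.
  - move=> x z E1; pose d := gpb_mk (E1 : f (h x) = gpi_proj f _ z).
    have E2 : h x = gpi_proj h (bmap a) (l1 d) by rewrite [RHS]gpi_lambdaP.
    have E3 : r2 (gpb_mk E2) = l1 d by [].
    by exists (gpb_mk E3).
apply: (@bnrm_iso_eval _ _ _ _ (gcomp f h) a c E e1 e2 ev).
- split=> // [e|]; first exact: gpi_lambdaP.
  by rewrite af_comp -lab_tr_comp -(lab_mackey _ (gpb_pullback _ _)).
- move=> z z' Ez H; apply: gpi_gapp_ext => [//|y h1 k1].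
  apply: gpi_gapp_ext => [|x h2 k2]; first by rewrite [LHS](gappP h1) [RHS](gappP k1).
  have [|e [E1 E2]] := is_pullback_surj pb (x := x) (y := z).
    by rewrite -[LHS]/(f (h x)) h2 -[RHS]h1; congr (f _); exact: gappP h1.
  have [|e' [E1' E2']] := is_pullback_surj pb (x := x) (y := z').
    by rewrite -[LHS]/(f (h x)) k2 -[RHS]k1; congr (f _); exact: gappP k1.
  by rewrite -(evE e z y h1 x h2) // -(evE e' z' y k1 x k2) // (H e e') // E1 E1'.
- move=> u.
  have h0 y x : f y = gpi_pt u -> h x = y -> gcomp f h x = gpi_pt u.
    by move=> <- <-.
  have sP y (h1 : f y = gpi_pt u) x (h2 : h x = y) : bmap a (gapp (h0 y x h1 h2)) = x.
    exact: gappP.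
  have tP y (h1 : f y = gpi_pt u) : gpi_proj h (bmap a) (gpi_mk (sP y h1)) = y by [].
  exists (gpi_mk tP) => // e k E2.
  have h1 : f (h (e1 e)) = gpi_pt (gpi_mk tP) by [].
  have h2 : h (e1 e) = gpi_pt (gapp h1) by exact/esym/(gappP h1).
  rewrite (evE e _ _ h1 _ h2) //.
  rewrite (@gapp_eq _ _ _ _ _ _ _ (gpi_mk (sP _ h1)) _ (e1 e) h2 erefl) ?gapp_mk //.
  exact: gapp_eq.
Qed.

(** In a pullback square f' identifies the fibre of g' over y with the fibre of g over [f y], hence
    also the sections over them. *)
Lemma bnrm_mackey X X' Y Y' (f : gmap Y' Y) (g : gmap X Y)
    (g' : gmap X' Y') (f' : gmap X' X) (a : bobj F X) :
  is_pullback f g g' f' -> biso (bres f (bnrm g a)) (bnrm g' (bres f' a)).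
Proof.
move=> pb; set c := bres f (bnrm g a).
have comm := is_pullback_comm pb.
have surj := is_pullback_surj pb.
pose E := gpb g' (bmap c).
have ek (w : E) : g (gcomp f' (gpb1 _ _) w)
    = gpi_proj g (bmap a) (gcomp (gpb1 _ _) (gpb2 _ _) w).
  by rewrite [LHS]comm (gpbP w); exact/esym/(gpbP (gpb2 _ _ w)).
pose l := gpi_lambda g (bmap a).
have eev (w : E) : bmap a (gcomp l (gpb_lift ek) w) = f' (gpb1 _ _ w).
  exact: gpi_lambdaP.
apply: (@bnrm_iso_eval _ _ _ _ g' (bres f' a) c E (gpb1 _ _) (gpb2 _ _) (gpb_lift eev)).
- split=> //; first exact: gpb_pullback.
  have pb' : is_pullback (gpb1 _ _ : gmap (bdom c) (bdom (bnrm g a)))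
      (gpi_rho g (bmap a)) (gpb2 _ _ : gmap E _) (gpb_lift ek).
    apply: is_pullbackI => // [v w [] E1 _ E2|w z E1].
      apply: gpb_ext => //; apply: (is_pullback_inj pb) => //.
      by rewrite !gpbP E2.
    have h : g (gpb1 _ _ w) = f (gpb2 _ _ z).
      exact: etrans (gpbP w) (etrans (congr1 (gpi_proj g (bmap a)) E1) (gpbP z)).
    have [x [E2 E3]] := surj _ _ h; have h' : g' x = bmap c z by [].
    by exists (gpb_mk h'); split=> //; apply: gpb_ext => //; exact/esym.
  by rewrite af_lift1 (af_comp _ (gpb_lift ek)) -(lab_mackey _ pb').
- move=> z z' Ez H; apply: gpb_ext => //; apply: gpi_gapp_ext => [|x h k].
    rewrite -[LHS]/(gpi_proj g (bmap a) _) -[RHS]/(gpi_proj g (bmap a) _).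
    by rewrite !gpbP; congr (f _).
  have h1 : g x = f (gpb2 _ _ z) by rewrite h; exact: gpbP z.
  have [x' [E2 E3]] := surj _ _ h1.
  have h2 : g' x' = bmap c z by [].
  have h3 : g' x' = bmap c z' by rewrite E3.
  have := congr1 (gpb1 _ _) (H (gpb_mk h2) (gpb_mk h3) erefl erefl erefl).
  rewrite -[LHS]/(gpi_lambda _ _ _) -[RHS]/(gpi_lambda _ _ _).
  by rewrite (gpi_lambdaE h) // (gpi_lambdaE k).
(* [s] inverts this identification of fibres, and [tP] transports the section u along it. *)
- move=> u; pose s x (h : g x = f (gpi_pt u)) := sval (cid (surj _ _ h)).
  have sf x (h : g x = f (gpi_pt u)) : f' (s x h) = x.
    by rewrite /s; case: cid => ? [].
  have sg x (h : g x = f (gpi_pt u)) : g' (s x h) = gpi_pt u.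
    by rewrite /s; case: cid => ? [].
  have tP x (h : g x = f (gpi_pt u)) : bmap a (gpb1 _ _ (gapp (sg x h))) = x.
    by rewrite gpbP -[gpb2 _ _ _]/(bmap (bres f' a) _) gappP sf.
  have ez : gpi_proj g (bmap a) (gpi_mk tP) = f (gpi_pt u) by [].
  exists (gpb_mk ez) => // w h E1; apply: gpb_ext; last exact/esym/(gappP h).
  have h1 : g (f' (gpb1 _ _ w)) = gpi_pt (gpi_mk tP) by rewrite comm h.
  apply: etrans (gpi_lambdaE (u := gpi_mk tP) h1 _ _) _ => //.
    exact: (congr1 (gpb1 _ _) E1).
  rewrite gapp_mk; congr (gpb1 _ _ _); apply: gapp_eq => //.
  by apply: (is_pullback_inj pb); rewrite ?sf ?sg.
Qed.

(** A section of the composite map to X amounts to a section sigma of p together with a lift of the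
    values of sigma through [bmap a]. *)
Lemma bnrm_exp A X Y (eta : gmap X Y) (p : gmap A X) (a : bobj F A) :
  biso (btr (gpi_proj eta p) (bnrm (gpi_rho eta p) (bres (gpi_lambda eta p) a)))
    (bnrm eta (btr p a)).
Proof.
pose l := gpi_lambda eta p; pose r := gpi_rho eta p; pose b := bres l a.
pose projP := gpi_proj eta p; pose projC := gpi_proj r (bmap b).
set c := btr _ _; pose E := gpb r projC.
pose e1 : gmap E X := gcomp (gpb1 _ _) (gpb1 _ _).
pose e2 : gmap E (bdom c) := gpi_rho r (bmap b).
pose ev : gmap E (bdom (btr p a)) := gcomp (gpb1 _ _) (gpi_lambda r (bmap b)).
have ev_map (e : E) : bmap a (ev e) = l (gpb1 _ _ e).
  by rewrite [LHS]gpbP; congr (l _); exact: gpi_lambdaP.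
have pb : is_pullback (bmap c) eta e2 e1.
  apply: is_pullbackI.
  - by move=> e; rewrite [LHS](gpbP (gpb1 _ _ e)); congr (projP _); exact: (gpbP e).
  - move=> v w E1 E2; apply: gpb_ext => //; apply: gpb_ext => //.
    by rewrite -[LHS]/(r _) -[RHS]/(r _) !gpbP; congr (projC _).
  - move=> x z h; have h' : r (gpb_mk (h : eta x = projP (projC z))) = projC z by [].
    by exists (gpb_mk h').
apply: (@bnrm_iso_eval _ _ _ _ eta (btr p a) c E e1 e2 ev).
- split=> // [e|]; last by rewrite af_comp.
  by rewrite -[LHS]/(p (bmap a (ev e))) ev_map; exact: gpi_lambdaP.
- move=> z z' Ez H.
  (* Composing with [bmap a] recovers the section of p, so these agree before the lifts are
     compared. *)
  have Ep : projC z = projC z'.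
    apply: gpi_gapp_ext => // x h k.
    have [e [E1 E2]] := is_pullback_surj pb (h : eta x = bmap c z).
    have [e' [E1' E2']] := is_pullback_surj pb (k : eta x = bmap c z').
    have := congr1 (bmap a) (H e e' E2 E2' (etrans E1 (esym E1'))).
    rewrite !ev_map (gpi_lambdaE h) //; last first.
      by rewrite -[LHS]/(r _) gpbP; congr (projC _).
    rewrite (gpi_lambdaE k) //.
    by rewrite -[LHS]/(r _) gpbP; congr (projC _).
  apply: gpi_gapp_ext => // w h k; apply: gpb_ext.
    have := H (gpb_mk (h : r w = projC z)) (gpb_mk (k : r w = projC z')) erefl erefl erefl.
    rewrite -[LHS]/(gpb1 _ _ (gpi_lambda _ _ _)) -[RHS]/(gpb1 _ _ (gpi_lambda _ _ _)).
    by rewrite (gpi_lambdaE h) // (gpi_lambdaE k).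
  exact: etrans (gappP h) (esym (gappP k)).
- move=> u.
  have sP x (h : eta x = gpi_pt u) : p (bmap a (gapp h)) = x by exact: (gappP h).
  have h0 w : r w = gpi_mk sP -> eta (gpb1 _ _ w) = gpi_pt u.
    by move=> h; rewrite gpbP; exact: (congr1 projP h).
  have tE w (h : r w = gpi_mk sP) : bmap a (gapp (h0 w h)) = l w.
    by rewrite /l (gpi_lambdaE (u := gpi_mk sP) (h0 w h)) // gapp_mk.
  have tP w (h : r w = gpi_mk sP) : bmap b (gpb_mk (tE w h)) = w by [].
  exists (gpi_mk tP) => // e h E2.
  have h1 : r (gpb1 _ _ e) = gpi_mk sP by rewrite gpbP; exact: (congr1 projC E2).
  apply: etrans (congr1 (gpb1 _ _) (gpi_lambdaE (u := gpi_mk tP) h1 erefl E2)) _.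
  by rewrite gapp_mk; exact: gapp_eq.
Qed.

End NormIso.

(** * The norm is polynomial *)

Section InvariantSubset.
Variables (gT : finGroupType) (X : gset gT) (Q : pred X).
Hypothesis Q_inv : forall x g, Q (x ⋅ g) = Q x.

Definition gsub_sort : Set := {x : X | Q x}.

Lemma gsub_op_subproof (u : gsub_sort) g : Q (val u ⋅ g).
Proof. by rewrite Q_inv; exact: valP. Qed.
Definition gsub_op (u : gsub_sort) g : gsub_sort :=
  exist _ (val u ⋅ g) (gsub_op_subproof u g).
Lemma gsub_act1 : gsub_op^~ 1%g =1 id.
Proof. by move=> u; apply: val_inj; rewrite /= gop1. Qed.
Lemma gsub_actM u : act_morph gsub_op u.
Proof. by move=> g h; apply: val_inj; rewrite /= gopM. Qed.

Definition gsub : gset gT :=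
  @GSet gT gsub_sort (finite_inj (@inj_id gsub_sort))
    (TotalAction gsub_act1 gsub_actM).
Definition gsub_in : gmap gsub X :=
  @GMap gT gsub X (fun u => val u) (fun u g => erefl).

Section Lift.
Variables (W : gset gT) (h : gmap W X) (hQ : forall w, Q (h w)).
Definition gsub_lift_fun (w : W) : gsub := exist _ (h w) (hQ w).
Lemma gsub_lift_equiv w g : gsub_lift_fun (w ⋅ g) = gsub_lift_fun w ⋅ g.
Proof. by apply: val_inj; exact: gmap_equiv. Qed.
Definition gsub_lift : gmap W gsub := GMap gsub_lift_equiv.
End Lift.

End InvariantSubset.

Section SubObject.
Variables (gT : finGroupType) (F : addFunctor gT) (Y : gset gT).
Implicit Types a b : bobj F Y.

Definition bsub a (Q : pred (bdom a)) (Qi : forall x g, Q (x ⋅ g) = Q x) : bobj F Y :=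
  BObj (gcomp (bmap a) (gsub_in Qi)) (af_res (gsub_in Qi) (blab a)).

Lemma bsub_iso a b (f : bhom a b) (Q : pred (bdom a)) (Q' : pred (bdom b))
    (Qi : forall x g, Q (x ⋅ g) = Q x) (Qi' : forall x g, Q' (x ⋅ g) = Q' x) :
  injective f -> (forall x, Q' (f x) = Q x) ->
  (forall y, Q' y -> exists x, f x = y) -> biso (bsub Qi) (bsub Qi').
Proof.
move=> fi QE fs.
have Qf (u : gsub Qi) : Q' (gcomp f (gsub_in Qi) u).
  by rewrite -[Q' _]/(Q' (f (val u))) QE; exact: valP.
apply: (@biso_bij _ _ _ (bsub Qi) (bsub Qi') (gsub_lift Qi' Qf)).
- by move=> u v [] /fi E; exact: val_inj.
- move=> [y Qy]; have [x E] := fs y Qy.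
  have Qx : Q x by rewrite -QE E.
  by exists (exist _ x Qx); exact: val_inj.
- by move=> u; exact: (bhom_overE f).
- rewrite -[RHS]/(af_res (gsub_in Qi) (blab a)) -(bhom_lab f) -af_comp.
  exact: af_res_res.
Qed.

Lemma bsub_split a (Q Q1 Q2 : pred (bdom a)) (Qi : forall x g, Q (x ⋅ g) = Q x)
    (Qi1 : forall x g, Q1 (x ⋅ g) = Q1 x) (Qi2 : forall x g, Q2 (x ⋅ g) = Q2 x) :
  (forall x, Q x = Q1 x || Q2 x) -> (forall x, Q1 x -> ~~ Q2 x) ->
  biso (bsum (bsub Qi1) (bsub Qi2)) (bsub Qi).
Proof.
move=> QE Qd.
have H1 (u : gsub Qi1) : Q (gsub_in Qi1 u) by rewrite QE (valP u).
have H2 (u : gsub Qi2) : Q (gsub_in Qi2 u) by rewrite QE (valP u) orbT.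
apply: (@biso_bij _ _ _ (bsum (bsub Qi1) (bsub Qi2)) (bsub Qi)
  (gcase (gsub_lift Qi H1) (gsub_lift Qi H2))).
- case=> u [] v [] E; first by congr inl; exact: val_inj.
  + have Euv : val u = val v := E.
    by have := Qd _ (valP u); rewrite Euv (valP v).
  + have Euv : val u = val v := E.
    by have := Qd _ (valP v); rewrite -Euv (valP u).
  + by congr inr; exact: val_inj.
- move=> [x Qx]; have := Qx; rewrite QE => /orP[h|h].
    by exists (inl (exist _ x h)); exact: val_inj.
  by exists (inr (exist _ x h)); exact: val_inj.
- by case.
- apply: af_sum_inj; rewrite -[X in af_res _ X = _]/(af_res _ (af_res _ _)) !af_simp;
  exact: af_res_res.
Qed.

Lemma bsub_full a (Q : pred (bdom a)) (Qi : forall x g, Q (x ⋅ g) = Q x) :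
  (forall x, Q x) -> biso (bsub Qi) a.
Proof.
move=> Qt; apply: (@biso_bij _ _ _ (bsub Qi) a (gsub_in Qi)) => //.
- exact: val_inj.
- by move=> y; exists (exist _ y (Qt y)).
Qed.

Lemma bsub_empty a (Q : pred (bdom a)) (Qi : forall x g, Q (x ⋅ g) = Q x) :
  (forall x, ~~ Q x) -> biso (bsub Qi) (bzero F Y).
Proof.
move=> Qf; apply: biso_sym.
apply: (@biso_bij _ _ _ (bzero F Y) (bsub Qi) (gvoid_map _)).
- by case.
- by move=> [y Qy]; have := Qf y; rewrite Qy.
- by case.
- exact: af_void_eq.
Qed.

End SubObject.

(** * Differences of the norm as sets of sections meeting prescribed parts *)

Section NormPolynomial.
Variables (gT : finGroupType) (M : semiMackey gT).
Variables (X Y : gset gT) (eta : gmap X Y).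
Local Notation F := (sm_contra M).
Implicit Types a b c : bobj F X.

Definition hits (A : gset gT) (p : gmap A X) (R : pred A) (u : gpi eta p) : bool :=
  `[< exists x (h : eta x = gpi_pt u), R (gapp h) >].

Lemma hits_inv (A : gset gT) (p : gmap A X) (R : pred A) :
  (forall w g, R (w ⋅ g) = R w) ->
  forall (u : gpi eta p) g, hits R (u ⋅ g) = hits R u.
Proof.
move=> Ri.
have H (u : gpi eta p) g : hits R u -> hits R (u ⋅ g).
  move=> /asboolP [x [h Rx]]; apply/asboolP; exists (x ⋅ g).
  have h' : eta (x ⋅ g) = gpi_pt (u ⋅ g) by rewrite gmap_equiv h.
  by exists h'; rewrite (gapp_act h) Ri.
move=> u g; apply/idP/idP; last exact: H.
by move/(H _ g^-1%g); rewrite gopK.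
Qed.

(** For a subobject, the norm consists of the sections with values in it. Tracking [hits] allows
    conditions on sections to be transported too. *)
Lemma bnrm_mono a b (f : bhom a b) : injective f ->
  exists phi : bhom (bnrm eta a) (bnrm eta b),
  [/\ injective phi,
      forall (R : pred (bdom a)) (R' : pred (bdom b)) (u : gpi eta (bmap a)),
        (forall w, R' (f w) = R w) -> hits R' (phi u) = hits R u &
      forall u : gpi eta (bmap b), (forall x (h : eta x = gpi_pt u),
        exists w, f w = gapp h) -> exists v, phi v = u].
Proof.
move=> fi; have [phi phiE] := bnrm_map (bnrm_bhom_eval eta f); exists phi.
have ptE (u : gpi eta (bmap a)) : gpi_pt (phi u) = gpi_pt u := bhom_overE phi u.
have appE (u : gpi eta (bmap a)) x (h : eta x = gpi_pt u)
    (k : eta x = gpi_pt (phi u)) : gapp k = f (gapp h).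
  pose w := gpb_mk (h : eta x = gpi_proj eta (bmap a) u).
  rewrite (phiE w k) -[LHS]/(f (gpi_lambda _ _ w)).
  by congr (f _); exact: gpi_lambdaE.
split.
- move=> u v E; have Ept : gpi_pt u = gpi_pt v by rewrite -ptE E ptE.
  apply: gpi_gapp_ext => // x h k; apply: fi.
  have h' : eta x = gpi_pt (phi u) by rewrite ptE.
  have k' : eta x = gpi_pt (phi v) by rewrite ptE.
  by rewrite -(appE _ _ h h') -(appE _ _ k k'); exact: gapp_eq.
- move=> R R' u RE; apply/asboolP/asboolP => -[x [h Rh]]; exists x.
    have h' : eta x = gpi_pt u by rewrite -ptE.
    by exists h'; rewrite -RE -(appE _ _ _ h).
  have h' : eta x = gpi_pt (phi u) by rewrite ptE.
  by exists h'; rewrite (appE _ _ h) RE.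
- move=> u H; pose s x (h : eta x = gpi_pt u) := sval (cid (H x h)).
  have sE x (h : eta x = gpi_pt u) : f (s x h) = gapp h by rewrite /s; case: cid.
  have sP x (h : eta x = gpi_pt u) : bmap a (s x h) = x.
    by rewrite -(bhom_overE f) sE gappP.
  exists (gpi_mk sP); apply: gpi_gapp_ext => [|x h k]; first exact: ptE.
  have h' : eta x = gpi_pt (gpi_mk sP) by rewrite k.
  by rewrite (appE _ _ h' h) gapp_mk sE; exact: gapp_eq.
Qed.

(** The directions are packed into one object with an invariant colouring, so that a difference of
    any order is a single subobject of the norm of [bsum a c]. *)
Definition colored a c (col : bdom c -> nat) (i : nat) (w : bdom (bsum a c)) : bool :=
  if w is inr z then col z == i else false.

Definition hits_all a c (col : bdom c -> nat) k (u : bdom (bnrm eta (bsum a c))) :=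
  all (fun i => hits (colored col i) u) (iota 0 k).

Lemma hits_all_inv a c (col : bdom c -> nat) k :
  (forall z g, col (z ⋅ g) = col z) ->
  forall u g, @hits_all a c col k (u ⋅ g) = hits_all col k u.
Proof.
move=> ci u g; apply: eq_all => i; apply: hits_inv.
by move=> [w|w] h //=; rewrite ci.
Qed.

(* When the colour classes of c are b_1, ..., b_k, this is the k-th difference of
   the norm at a in the directions b_1, ..., b_k. *)
Definition bcolor a c (col : bdom c -> nat) (ci : forall z g, col (z ⋅ g) = col z) k :=
  bsub (@hits_all_inv a c col k ci).

Section Step.
Variables (a b c : bobj F X) (k : nat) (col : bdom c -> nat).
Hypotheses (ci : forall z g, col (z ⋅ g) = col z) (col_lt : forall z, (col z < k)%N).

Definition col_add (w : bdom (bsum b c)) : nat := if w is inr z then col z else k.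

Lemma col_add_inv z g : col_add (z ⋅ g) = col_add z.
Proof. by case: z => z //=; rewrite ci. Qed.

Lemma col_add_lt z : (col_add z < k.+1)%N.
Proof. by case: z => z //=; exact: leqW. Qed.

(** A section of a + b + c either avoids b, and is then a section of a + c, or meets b, which
    becomes the colour class k. Hence a difference in direction b adds one colour. *)
Lemma bcolor_step :
  biso (bsum (bcolor a ci k) (bcolor a col_add_inv k.+1)) (bcolor (bsum a b) ci k).
Proof.
pose W := bsum (bsum a b) c.
pose in_b (w : bdom W) : bool := if w is inl (inr _) then true else false.
have in_b_inv w g : in_b (w ⋅ g) = in_b w by case: w => [[w|w]|w].
pose Q1 (u : bdom (bnrm eta W)) := hits_all col k u && ~~ hits in_b u.
pose Q2 (u : bdom (bnrm eta W)) := hits_all col k u && hits in_b u.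
have Qi1 u g : Q1 (u ⋅ g) = Q1 u by rewrite /Q1 hits_all_inv // hits_inv.
have Qi2 u g : Q2 (u ⋅ g) = Q2 u by rewrite /Q2 hits_all_inv // hits_inv.
apply: biso_trans (bsub_split (hits_all_inv k ci) Qi1 Qi2 _ _); last 2 first.
- by move=> u; rewrite /Q1 /Q2 -andb_orr orNb andbT.
- by move=> u /andP[_ H]; rewrite /Q2 negb_and H orbT.
apply: bsum_iso.
- pose f : gmap (bdom (bsum a c)) (bdom W) :=
    gcase (gcomp (ginl _ _) (ginl _ _)) (ginr _ _).
  have f_over : gcomp (bmap W) f = bmap (bsum a c) by apply: gmap_eq; case.
  have f_lab : af_res f (blab W) = blab (bsum a c).
    by apply: af_sum_inj; rewrite !af_simp.
  have fi : injective f by move=> [x|x] [y|y] //= [->].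
  have [phi [phi_inj phiE phi_surj]] := bnrm_mono (f := BHom f_over f_lab) fi.
  apply: (bsub_iso (f := phi)) => // [u|u].
    rewrite /Q1 (phiE pred0) => [|[]//].
    have -> : hits pred0 u = false by apply/asboolP => -[? []].
    by rewrite andbT; apply: eq_all => i; apply: phiE; case.
  move=> /andP[_ /asboolP H]; apply: phi_surj => x h.
  case E: (gapp h) => [[w|w]|w]; [by exists (inl w) | | by exists (inr w)].
  by case: H; exists x, h; rewrite E.
- pose f : gmap (bdom (bsum a (bsum b c))) (bdom W) :=
    gcase (gcomp (ginl _ _) (ginl _ _)) (gcase (gcomp (ginl _ _) (ginr _ _)) (ginr _ _)).
  have f_over : gcomp (bmap W) f = bmap (bsum a (bsum b c)).
    by apply: gmap_eq; case=> [x|[x|x]].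
  have f_lab : af_res f (blab W) = blab (bsum a (bsum b c)).
    apply: af_sum_inj; first by rewrite !af_simp.
    by rewrite !af_simp; apply: af_sum_inj; rewrite !af_simp.
  have fi : injective f by move=> [x|[x|x]] [y|[y|y]] //= [->].
  have [phi [phi_inj phiE phi_surj]] := bnrm_mono (f := BHom f_over f_lab) fi.
  apply: (bsub_iso (f := phi)) => // [u|u _].
    rewrite /Q2 /hits_all -addn1 iotaD all_cat /= andbT; congr (_ && _).
      apply: eq_in_all => i; rewrite mem_iota => /andP[_ ik].
      by apply: phiE => -[w|[w|w]] //=; rewrite (gtn_eqF ik).
    (* All colours on c are below k, so the class of colour k is exactly b. *)
    by apply: phiE => -[w|[w|w]] //=; rewrite ?eqxx // (ltn_eqF (col_lt w)).
  apply: phi_surj => x h.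
  case: (gapp h) => [[w|w]|w].
  - by exists (inl w).
  - by exists (inr (inl w)).
  - by exists (inr (inr w)).
Qed.

End Step.

(** Meeting k disjoint colour classes requires k distinct arguments in one fibre, and a fibre has at
    most [#|X|] points. *)
Lemma bcolor_empty a c (col : bdom c -> nat) (ci : forall z g, col (z ⋅ g) = col z) k :
  (#|{: X}| < k)%N -> biso (bcolor a ci k) (bzero F Y).
Proof.
move=> Xk; apply: bsub_empty => u; apply/allP => H.
have {}H (i : 'I_k) : exists x (h : eta x = gpi_pt u), colored col i (gapp h).
  by apply/asboolP; apply: (H i); rewrite mem_iota add0n ltn_ord.
pose x i := sval (cid (H i)).
have xP i : exists h : eta (x i) = gpi_pt u, colored col i (gapp h).
  by rewrite /x; case: cid.
have x_inj : injective x.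
  move=> i j E; have [h Hi] := xP i; have [h' Hj] := xP j.
  move: Hi Hj; rewrite (gapp_eq h h') //.
  by case: (gapp h') => //= z /eqP -> /eqP; exact: val_inj.
by have := leq_card x x_inj; rewrite card_ord leqNgt Xk.
Qed.

(** Each difference trades one unit of j for one more colour; at j = 0 there are more colours than
    points of X. The map v moves classes into a group, where differences make sense. *)
Lemma bcolor_deg_lt (B : zmodType) (v : bcls F Y -> B) j :
  nmod_morphism v ->
  forall k c (col : bdom c -> nat) (ci : forall z g, col (z ⋅ g) = col z)
    (n : bcls F X -> B),
  (forall z, (col z < k)%N) -> (k + j)%N = #|{: X}|.+1 ->
  (forall a, n (bcls_of a) = v (bcls_of (bcolor a ci k))) -> deg_lt j n.
Proof.
move=> [v0 vD]; elim: j => [|j IH] k c col ci n col_lt Ek nE.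
  elim/bcls_ind => a; rewrite nE -v0; congr v; apply/bcls_eq/bcolor_empty.
  by rewrite -Ek addn0.
elim/bcls_ind => b; apply: (IH k.+1 _ _ (col_add_inv (b := b) k ci)).
- exact: col_add_lt.
- by rewrite addSnnS.
- move=> a; rewrite bcls_ofD !nE; apply/eqP; rewrite subr_eq addrC -vD bcls_ofD; apply/eqP.
  congr v; apply/bcls_eq/biso_sym; exact: bcolor_step.
Qed.

Lemma bnrm_deg_lt (B : zmodType) (v : bcls F Y -> B) (n : bcls F X -> B) :
  nmod_morphism v -> (forall a, n (bcls_of a) = v (bcls_of (bnrm eta a))) ->
  deg_lt #|{: X}|.+1 n.
Proof.
move=> vP nE.
have ci (z : bdom (bzero F X)) (g : gT) : 0%N = 0%N by [].
(* With no colours and c empty nothing is required of a section, which leaves the norm of a + 0. *)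
apply: (@bcolor_deg_lt _ v _ vP 0 (bzero F X) (fun=> 0%N) ci) => // a.
rewrite nE; congr v; apply/bcls_eq/biso_sym.
apply: biso_trans (bsub_full _ _) _ => //.
by apply/bnrm_iso/(biso_trans (bsumC _ _))/bsum0.
Qed.

End NormPolynomial.

(** * The norm on Grothendieck rings *)

Section BurnsideNorm.
Variables (gT : finGroupType) (M : semiMackey gT).
Local Notation F := (sm_contra M).
Implicit Types X Y Z A : gset gT.

Definition bcls_nrm X Y (eta : gmap X Y) (u : bcls F X) : bcls F Y :=
  bcls_of (bnrm eta (bcls_repr u)).

Lemma bcls_nrmE X Y (eta : gmap X Y) (a : bobj F X) :
  bcls_nrm eta (bcls_of a) = bcls_of (bnrm eta a).
Proof. by apply/bcls_eq/bnrm_iso; exact: bcls_repr_of. Qed.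

Lemma burn_nrm_ex X Y (eta : gmap X Y) : exists n : burn F X -> burn F Y,
  polynomial n /\ forall u, n (groth_in u) = groth_in (bcls_nrm eta u).
Proof.
have H : deg_lt #|{: X}|.+1 (fun u => groth_in (bcls_nrm eta u) : burn F Y).
  apply: (bnrm_deg_lt (eta := eta) (groth_in_nmod (bcls F Y))) => a.
  by rewrite bcls_nrmE.
by have [n [n_deg nE]] := deg_lt_groth_ext H; exists n; split=> //; exists #|{: X}|.+1.
Qed.

(** By [polynomial_groth_eq] this extension is the only polynomial one. *)
Definition burn_nrm X Y (eta : gmap X Y) : burn F X -> burn F Y :=
  sval (cid (burn_nrm_ex eta)).

Lemma burn_nrm_poly X Y (eta : gmap X Y) : polynomial (burn_nrm eta).
Proof. by rewrite /burn_nrm; case: cid => ? []. Qed.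

Lemma burn_nrm_in X Y (eta : gmap X Y) (u : bcls F X) :
  burn_nrm eta (groth_in u) = groth_in (bcls_nrm eta u).
Proof. by rewrite /burn_nrm; case: cid => ? []. Qed.

Lemma burn_res_in X Y (f : gmap X Y) (u : bcls F Y) :
  burn_res f (groth_in u) = groth_in (bcls_res f u).
Proof. exact/groth_map_in/bcls_res_nmod. Qed.

Lemma burn_res_poly X Y (f : gmap X Y) : polynomial (burn_res (F := F) f).
Proof. by apply: polynomial_morph; exact/groth_map_zmod/bcls_res_nmod. Qed.

Lemma burn_tr_poly X Y (f : gmap X Y) : polynomial (burn_tr (F := F) f).
Proof. by apply: polynomial_morph; exact: burn_tr_zmod. Qed.

Lemma mulr_poly (R : comPzRingType) (x : R) : polynomial ( *%R^~ x).
Proof. by apply: polynomial_morph => y z; exact: mulrBl. Qed.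

Lemma burn_nrm_monoid X Y (eta : gmap X Y) : monoid_morphism (burn_nrm eta).
Proof.
have [in1 inM] := groth_in_monoid (bcls F X).
have [in1' inM'] := groth_in_monoid (bcls F Y).
split=> [|x y].
  rewrite -[1](groth_in_monoid (bcls F X)).1 burn_nrm_in bcls_nrmE -[RHS]in1'.
  congr groth_in; exact/bcls_eq/bnrm_one.
have P := burn_nrm_poly eta.
(* One factor is reduced at a time: with the other fixed, both sides are polynomial. *)
move: x; apply: polynomial_groth_eq => [||u].
- exact: polynomial_comp P (mulr_poly y).
- exact: polynomial_comp (mulr_poly _) P.
rewrite mulrC [RHS]mulrC; move: y; apply: polynomial_groth_eq => [||w].
- exact: polynomial_comp P (mulr_poly _).
- exact: polynomial_comp (mulr_poly _) P.
rewrite -inM !burn_nrm_in -inM'; congr groth_in.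
elim/bcls_ind: u => a; elim/bcls_ind: w => b.
rewrite bcls_ofM !bcls_nrmE bcls_ofM; exact/bcls_eq/bnrm_prod.
Qed.

Lemma burn_nrm_id X (x : burn F X) : burn_nrm (gid X) x = x.
Proof.
move: x; apply: polynomial_groth_eq => [||u]; first exact: burn_nrm_poly.
  by apply: polynomial_morph => y z.
rewrite burn_nrm_in; congr groth_in; elim/bcls_ind: u => a.
rewrite bcls_nrmE; exact/bcls_eq/bnrm_id.
Qed.

(** Norms are not additive, so it is closure of polynomial maps under composition that makes the
    right-hand side polynomial. *)
Lemma burn_nrm_comp X Y Z (f : gmap Y Z) (h : gmap X Y) (x : burn F X) :
  burn_nrm (gcomp f h) x = burn_nrm f (burn_nrm h x).
Proof.
move: x; apply: polynomial_groth_eq => [||u]; first exact: burn_nrm_poly.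
  by apply: polynomial_comp; exact: burn_nrm_poly.
rewrite !burn_nrm_in; congr groth_in; elim/bcls_ind: u => a.
rewrite !bcls_nrmE; exact/bcls_eq/bnrm_comp.
Qed.

Lemma burn_nrm_mackey X X' Y Y' (f : gmap Y' Y) (g : gmap X Y)
    (g' : gmap X' Y') (f' : gmap X' X) (x : burn F X) :
  is_pullback f g g' f' -> burn_res f (burn_nrm g x) = burn_nrm g' (burn_res f' x).
Proof.
move=> pb; move: x; apply: polynomial_groth_eq => [||u].
- exact: polynomial_comp (burn_res_poly f) (burn_nrm_poly g).
- exact: polynomial_comp (burn_nrm_poly g') (burn_res_poly f').
rewrite burn_nrm_in !burn_res_in burn_nrm_in; congr groth_in.
elim/bcls_ind: u => a; rewrite bcls_nrmE !bcls_resE bcls_nrmE.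
exact/bcls_eq/bnrm_mackey.
Qed.

Lemma burn_nrm_exp A X Y (eta : gmap X Y) (p : gmap A X) (x : burn F A) :
  burn_tr (gpi_proj eta p)
    (burn_nrm (gpi_rho eta p) (burn_res (gpi_lambda eta p) x))
  = burn_nrm eta (burn_tr p x).
Proof.
move: x; apply: polynomial_groth_eq => [||u].
- apply: polynomial_comp (burn_tr_poly _) _.
  exact: polynomial_comp (burn_nrm_poly _) (burn_res_poly _).
- exact: polynomial_comp (burn_nrm_poly _) (burn_tr_poly _).
rewrite burn_res_in burn_nrm_in !burn_tr_in burn_nrm_in; congr groth_in.
elim/bcls_ind: u => a; rewrite bcls_resE bcls_nrmE !bcls_trE bcls_nrmE.
exact/bcls_eq/bnrm_exp.
Qed.

Lemma burn_nrm_semiMackey :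
  @is_semiMackey gT (fun X => multMon (burn F X)) (@burn_res gT F) burn_nrm.
Proof.
split.
- split=> [X Y f|X x|X Y Z f h x].
  + exact: burn_res_monoid.
  + exact: (contra_id (burn_res_contra F)).
  + exact: (contra_comp (burn_res_contra F)).
- split=> [X Y f|X x|X Y Z f h x].
  + exact: burn_nrm_monoid.
  + exact: burn_nrm_id.
  + exact: burn_nrm_comp.
- by move=> X X' Y Y' f g g' f' pb x; exact: burn_nrm_mackey.
(* Additivity concerns only the underlying sets and restrictions, which both monoid structures
   share. *)
- split; first exact: burn_void.
  by move=> X Y; exact: (add_sum (burn_additive F) X Y).
Qed.

Definition burn_tambara : tambara gT :=
  Tambara (green_mackey (burnside_is_green F)) burn_nrm_semiMackey burn_nrm_exp.

End BurnsideNorm.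

Theorem theorem2 (gT : finGroupType) (F : addFunctor gT)
  (hF : exists M : semiMackey gT, sm_contra M = F) :
  exists T : tambara gT, tam_green_data T = burnside F :> greenData gT.
Proof. by case: hF => M <-; exists (burn_tambara M). Qed.
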